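(* Let $M$ be a locally $\aleph_0$-categorical structure equipped with a localising metric, let $G = \mathrm{Aut}(M)$, and let $K$ be a compact space. Then a predicate $P \colon M^n \to K$ is definable (without parameters) if and only if it is uniformly continuous and properly $G$-invariant.
   Context: Continuous logic with formulas allowed to take values in $[-\infty,\infty]$. With $T=\mathrm{Th}(M)$, $P$ is definable if there is a continuous $\tilde P:\mathrm{S}_n(T)\to K$ with $P(a)=\tilde P(\mathrm{tp}(a))$; uniform continuity refers to the metric on $M^n$ (max metric) and the unique uniformity of $K$. A type is isolated if the logic topology and the type-metric topology coincide at it. A theory in a separable language is locally $\aleph_0$-categorical if, with $a\sim b\iff\mathrm{tp}(a,b)$ isolated: $\sim$ is an equivalence relation on every model, each $\sim$-class (local component) is an elementary substructure, a map between models is elementary iff it is elementary on each class and sends distinct classes to distinct classes, and there is a unique separable local model (one class) up to isomorphism; $M$ is locally $\aleph_0$-categorical if $\mathrm{Th}(M)$ is and $M$ is that model. A localising metric is a definable generalised metric ($[0,\infty]$-valued metric formula) with $d(a,b)<\infty\iff a\sim b$ in every model. Proper invariance: fix a left-invariant pseudo-metric $d_L$ on $G$ coarsely compatible with the action, i.e. $d_L(g^k,h^k)\to\infty$ iff $d(g^kx,h^kx)\to\infty$ for some (any) $x\in M$ (e.g. $d_L(g,h)=d(gx,hx)$); the notion below does not depend on the choice. For an equivalence relation $\sim$ on $\{0,\dots,n-1\}$ with classes $n/{\sim}$, $G^{n/\sim}$ acts on $M^n$ by $(gx)_I=g_Ix_I$ for each class $I$; a sequence $g^k\in G^{n/\sim}$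 satisfies $g^k\rightsquigarrow\infty$ if $d_L(g^k_I,g^k_J)\to\infty$ for all classes $I\neq J$ (vacuous if there is one class). $P$ is $\sim$-properly $G$-invariant if for all $x\in M^n$ and all $g^k\rightsquigarrow\infty$ in $G^{n/\sim}$, $P(g^kx)$ converges; $P$ is properly $G$-invariant if this holds for every equivalence relation $\sim$ on $\{0,\dots,n-1\}$ (in particular, $P$ is $G$-invariant). *)

(* Defs.v *)
From HB Require Import structures.
From mathcomp Require Import all_boot all_order all_algebra.
From mathcomp Require Import generic_quotient.
From mathcomp Require Import all_classical all_reals all_analysis.
Set Implicit Arguments.
Unset Strict Implicit.
Unset Printing Implicit Defensive.
Import Order.TTheory GRing.Theory Num.Theory.
Import numFieldNormedType.Exports.

Local Open Scope classical_set_scope.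
Local Open Scope quotient_scope.
Local Open Scope ring_scope.

(** * Continuous logic with values in [-oo, +oo] *)

(** The compact space [\bar R] carries its unique uniformity, which
    MathComp-Analysis presents through the metric
    [`|contract x - contract y|]. Moduli of uniform continuity of relation
    symbols are expressed with that metric. *)

Record language (R : realType) := Language {
  fun_sym : Type;
  fun_ar : fun_sym -> nat;
  fun_mod : fun_sym -> R -> R;
  fun_mod_gt0 : forall f e, 0 < e -> 0 < fun_mod f e;
  rel_sym : Type;
  rel_ar : rel_sym -> nat;
  rel_mod : rel_sym -> R -> R;
  rel_mod_gt0 : forall r e, 0 < e -> 0 < rel_mod r e
}.

(** Generalised metric: a genuine metric, except that +oo is allowed. *)
Definition gen_metric (R : realType) (X : Type) (d : X -> X -> \bar R) : Prop :=
  [/\ forall x y, (0 <= d x y)%E,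
      forall x y, d x y = 0%E <-> x = y,
      forall x y, d x y = d y x &
      forall x y z, (d x z <= d x y + d y z)%E].

Definition max_dist (R : realType) (X : Type) (d : X -> X -> \bar R) (n : nat)
    (x y : 'I_n -> X) : \bar R :=
  \big[maxe/0%E]_(i < n) d (x i) (y i).

Definition complete_metric (R : realType) (X : Type) (d : X -> X -> \bar R) :=
  forall u : nat -> X,
    (forall e : R, 0 < e -> exists m : nat, forall j k : nat,
      (m <= j)%N -> (m <= k)%N -> (d (u j) (u k) < e%:E)%E) ->
    exists l : X, forall e : R, 0 < e -> exists m : nat, forall k : nat,
      (m <= k)%N -> (d (u k) l < e%:E)%E.

(** The distance symbol of a structure may itself take the value +oo, as any
    other atomic formula; bounded metrics are a special case. *)
Record mstructure (R : realType) (L : language R) := MStructure {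
  carrier :> Type;
  carrier_inhabited : inhabited carrier;
  dist : carrier -> carrier -> \bar R;
  dist_gen_metric : gen_metric dist;
  dist_complete : complete_metric dist;
  fun_interp : forall f : fun_sym L, ('I_(fun_ar f) -> carrier) -> carrier;
  rel_interp : forall r : rel_sym L, ('I_(rel_ar r) -> carrier) -> \bar R;
  fun_interp_uc : forall (f : fun_sym L) (e : R) (x y : 'I_(fun_ar f) -> carrier),
    0 < e -> (max_dist dist x y < (fun_mod f e)%:E)%E ->
    (dist (fun_interp x) (fun_interp y) <= e%:E)%E;
  rel_interp_uc : forall (r : rel_sym L) (e : R) (x y : 'I_(rel_ar r) -> carrier),
    0 < e -> (max_dist dist x y < (rel_mod r e)%:E)%E ->
    `|contract (rel_interp x) - contract (rel_interp y)| <= e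
}.
Arguments fun_interp {R L} m f _.
Arguments rel_interp {R L} m r _.
Arguments dist {R L m}.

Inductive term (R : realType) (L : language R) (n : nat) : Type :=
| TVar of 'I_n
| TApp (f : fun_sym L) of ('I_(fun_ar f) -> term L n).

(** [formula L n]: formulas whose free variables are among x_0, ..., x_(n-1).
    A quantifier binds variable 0 of its body and shifts the other ones.
    Connectives are all continuous maps [-oo,+oo]^k -> [-oo,+oo]. *)
Inductive formula (R : realType) (L : language R) : nat -> Type :=
| FDist n of term L n & term L n : formula L n
| FRel n (r : rel_sym L) of ('I_(rel_ar r) -> term L n) : formula L n
| FConn n k (c : {ptws 'I_k -> \bar R} -> \bar R) of
    continuous c & ('I_k -> formula L n) : formula L n
| FSup n of formula L n.+1 : formula L n
| FInf n of formula L n.+1 : formula L n.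

Definition tcons (X : Type) (n : nat) (x : X) (a : 'I_n -> X) : 'I_n.+1 -> X :=
  fun i => if unlift ord0 i is Some j then a j else x.

Fixpoint teval (R : realType) (L : language R) (N : mstructure L) (n : nat)
    (a : 'I_n -> N) (t : term L n) : N :=
  match t with
  | TVar i => a i
  | TApp f s => fun_interp N f (fun j => teval a (s j))
  end.

Fixpoint eval (R : realType) (L : language R) (N : mstructure L) (n : nat)
    (phi : formula L n) : ('I_n -> N) -> \bar R :=
  match phi in formula _ m return ('I_m -> N) -> \bar R with
  | FDist _ s t => fun a => dist (teval a s) (teval a t)
  | FRel _ r s => fun a => rel_interp N r (fun j => teval a (s j))
  | FConn _ _ c _ psi => fun a => c (fun j => eval (psi j) a)
  | FSup _ psi => fun a => ereal_sup [set eval psi (tcons x a) | x in [set: N]]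
  | FInf _ psi => fun a => ereal_inf [set eval psi (tcons x a) | x in [set: N]]
  end.

(** Separability of the language: formulas are separable for uniform
    convergence (in particular every countable signature qualifies). *)
Definition separable_language (R : realType) (L : language R) : Prop :=
  forall n, exists u : nat -> formula L n,
    forall (phi : formula L n) (e : R), 0 < e -> exists k : nat,
      forall (N : mstructure L) (a : 'I_n -> N),
        ball (eval phi a) e (eval (u k) a).

(** A theory is a set of sentences; its models give them the value 0. As all
    continuous connectives are available, this expresses arbitrary closed
    conditions on sentences. *)
Definition theory (R : realType) (L : language R) := set (formula L 0).

Definition model (R : realType) (L : language R) (T : theory L)
    (N : mstructure L) : Prop :=
  forall phi, T phi -> forall a : 'I_0 -> N, eval phi a = 0%E.

Definition Th (R : realType) (L : language R) (N : mstructure L) : theory L :=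
  [set phi | forall a : 'I_0 -> N, eval phi a = 0%E].

(** * Types *)

(** Types are identified with the function sending a formula to its value; the
    logic topology on [types T n] (the space S_n(T)) is the topology induced by
    pointwise convergence. *)
Definition ptype (R : realType) (L : language R) (n : nat) :=
  {ptws formula L n -> \bar R}.

Definition tp (R : realType) (L : language R) (N : mstructure L) (n : nat)
    (a : 'I_n -> N) : ptype L n :=
  fun phi => eval phi a.

Definition types (R : realType) (L : language R) (T : theory L) (n : nat) :
    set (ptype L n) :=
  [set p | exists N : mstructure L, model T N /\ exists a : 'I_n -> N, p = tp a].

Definition type_dist (R : realType) (L : language R) (T : theory L) (n : nat)
    (p q : ptype L n) : \bar R :=
  ereal_inf [set r | exists N : mstructure L, model T N /\
    exists a b : 'I_n -> N,
      [/\ tp a = p, tp b = q & r = max_dist dist a b]].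

(** The logic and metric topologies on S_n(T) have the same neighbourhoods of
    p. *)
Definition isolated_type (R : realType) (L : language R) (T : theory L) (n : nat)
    (p : ptype L n) : Prop :=
  types T p /\
  forall U : set (ptype L n),
    within (types T (n := n)) (nbhs p) U <->
    exists2 e : R, 0 < e &
      forall q, types T q -> (type_dist T p q < e%:E)%E -> U q.

(** A predicate with values in a compact space is definable over a structure
    when it factors through a continuous map on the type space. *)
Definition definable (R : realType) (L : language R) (M : mstructure L)
    (K : topologicalType) (n : nat) (P : ('I_n -> M) -> K) : Prop :=
  exists Pt : ptype L n -> K,
    {within types (Th M) (n := n), continuous Pt} /\
    forall a, P a = Pt (tp a).

(** * Maps between structures *)

Definition elementary (R : realType) (L : language R) (N N' : mstructure L)
    (f : N -> N') : Prop :=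
  forall n (phi : formula L n) (a : 'I_n -> N), eval phi (f \o a) = eval phi a.

(** Up to renaming, an elementary substructure is the same thing as the image
    of an elementary embedding. *)
Definition elementary_substructure (R : realType) (L : language R)
    (N : mstructure L) (C : set N) : Prop :=
  exists (N0 : mstructure L) (f : N0 -> N), elementary f /\ range f = C.

(** Elementarity of the restriction of f to C. This is used when C is an
    elementary substructure of N, so that formulas may be evaluated in N. *)
Definition elementary_on (R : realType) (L : language R) (N N' : mstructure L)
    (C : set N) (f : N -> N') : Prop :=
  forall n (phi : formula L n) (a : 'I_n -> N),
    (forall i, C (a i)) -> eval phi (f \o a) = eval phi a.

Definition isomorphism (R : realType) (L : language R) (N N' : mstructure L)
    (f : N -> N') : Prop :=
  [/\ bijective f,
      forall x y, dist (f x) (f y) = dist x y,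
      forall s x, f (fun_interp N s x) = fun_interp N' s (f \o x) &
      forall r x, rel_interp N' r (f \o x) = rel_interp N r x].

Definition separable_structure (R : realType) (L : language R)
    (N : mstructure L) : Prop :=
  exists u : nat -> N, forall (x : N) (e : R), 0 < e ->
    exists k, (dist (u k) x < e%:E)%E.

(** * Local categoricity *)

Definition pair2 (X : Type) (a b : X) : 'I_2 -> X := tnth [tuple a; b].

Definition loc (R : realType) (L : language R) (T : theory L)
    (N : mstructure L) (a b : N) : Prop :=
  isolated_type T (tp (pair2 a b)).

Definition local_model (R : realType) (L : language R) (T : theory L)
    (N : mstructure L) : Prop :=
  model T N /\ forall a b : N, loc T a b.

Definition loc_equivalence (R : realType) (L : language R) (T : theory L) :
    Prop :=
  forall N : mstructure L, model T N ->
    [/\ forall a : N, loc T a a,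
        forall a b : N, loc T a b -> loc T b a &
        forall a b c : N, loc T a b -> loc T b c -> loc T a c].

Definition loc_classes_elementary (R : realType) (L : language R)
    (T : theory L) : Prop :=
  forall N : mstructure L, model T N ->
    forall a : N, elementary_substructure [set b | loc T a b].

Definition loc_elementary_maps (R : realType) (L : language R)
    (T : theory L) : Prop :=
  forall (N N' : mstructure L), model T N -> model T N' ->
    forall f : N -> N',
      elementary f <->
      (forall a : N, elementary_on [set b | loc T a b] f) /\
      (forall a b : N, ~ loc T a b -> ~ loc T (f a) (f b)).

Definition unique_separable_local_model (R : realType) (L : language R)
    (T : theory L) : Prop :=
  (exists N : mstructure L, separable_structure N /\ local_model T N) /\
  forall N N' : mstructure L,
    separable_structure N -> local_model T N ->
    separable_structure N' -> local_model T N' ->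
    exists f : N -> N', isomorphism f.

Definition locally_aleph0_categorical_theory (R : realType) (L : language R)
    (T : theory L) : Prop :=
  [/\ separable_language L,
      loc_equivalence T,
      loc_classes_elementary T,
      loc_elementary_maps T &
      unique_separable_local_model T].

Definition locally_aleph0_categorical (R : realType) (L : language R)
    (M : mstructure L) : Prop :=
  [/\ locally_aleph0_categorical_theory (Th M),
      separable_structure M & local_model (Th M) M].

(** A definable binary predicate, given as a continuous function on S_2(T), and
    its interpretation in a structure. *)
Definition interp2 (R : realType) (L : language R) (d : ptype L 2 -> \bar R)
    (N : mstructure L) (a b : N) : \bar R :=
  d (tp (pair2 a b)).

Definition localising_metric (R : realType) (L : language R) (T : theory L)
    (d : ptype L 2 -> \bar R) : Prop :=
  {within types T (n := 2), continuous d} /\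
  forall N : mstructure L, model T N ->
    gen_metric (@interp2 R L d N) /\
    forall a b : N, (interp2 d a b < +oo)%E <-> loc T a b.

(** * Automorphisms and proper invariance *)

Record Aut (R : realType) (L : language R) (M : mstructure L) := MkAut {
  aut_fun :> M -> M;
  aut_isomorphism : isomorphism aut_fun
}.

Lemma isomorphism_comp (R : realType) (L : language R)
    (N N' N'' : mstructure L) (f : N' -> N'') (g : N -> N') :
  isomorphism f -> isomorphism g -> isomorphism (f \o g).
Proof.
move=> [bf df ff rf] [bg dg fg rg]; split => [|x y|s x|r x].
- exact: bij_comp.
- by rewrite /= df dg.
- by rewrite /= fg ff.
- by rewrite -rg -rf.
Qed.

Definition aut_mul (R : realType) (L : language R) (M : mstructure L)
    (g h : Aut M) : Aut M :=
  MkAut (isomorphism_comp (aut_isomorphism g) (aut_isomorphism h)).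

Definition left_invariant_pseudometric (R : realType) (L : language R)
    (M : mstructure L) (dL : Aut M -> Aut M -> R) : Prop :=
  [/\ forall g, dL g g = 0,
      forall g h, dL g h = dL h g,
      forall f g h, dL f h <= dL f g + dL g h &
      forall f g h, dL (aut_mul f g) (aut_mul f h) = dL g h].

Definition coarsely_compatible (R : realType) (L : language R)
    (M : mstructure L) (d : M -> M -> \bar R) (dL : Aut M -> Aut M -> R) : Prop :=
  forall g h : nat -> Aut M,
    dL (g k) (h k) @[k --> \oo] --> +oo <->
    exists x : M, d (g k x) (h k x) @[k --> \oo] --> +oo%E.

(** For an equivalence relation e on {0, ..., n-1}, the action of G^(n/e) on
    M^n. *)
Definition class_act (R : realType) (L : language R) (M : mstructure L)
    (n : nat) (e : equiv_rel 'I_n) (g : {eq_quot e} -> Aut M)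
    (x : 'I_n -> M) : 'I_n -> M :=
  fun i => g (\pi_({eq_quot e}) i)%qT (x i).

Definition tends_apart (R : realType) (L : language R) (M : mstructure L)
    (dL : Aut M -> Aut M -> R) (n : nat) (e : equiv_rel 'I_n)
    (g : nat -> {eq_quot e} -> Aut M) : Prop :=
  forall I J : {eq_quot e}, I != J -> dL (g k I) (g k J) @[k --> \oo] --> +oo.

Definition properly_invariant (R : realType) (L : language R)
    (M : mstructure L) (dL : Aut M -> Aut M -> R) (K : topologicalType)
    (n : nat) (P : ('I_n -> M) -> K) : Prop :=
  forall (e : equiv_rel 'I_n) (x : 'I_n -> M)
    (g : nat -> {eq_quot e} -> Aut M),
    tends_apart dL g ->
    exists l : K, P (class_act (g k) x) @[k --> \oo] --> l.

Definition predicate_unif_continuous (R : realType) (L : language R) (M : mstructure L)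
    (K : uniformType) (n : nat) (P : ('I_n -> M) -> K) : Prop :=
  forall V : set (K * K), entourage V ->
    exists2 delta : R, 0 < delta &
      forall x y : 'I_n -> M,
        (max_dist dist x y < delta%:E)%E -> V (P x, P y).

(* Main.v *)
(** Let M^U be the ultrapower of M along a free ultrafilter U on the natural
    numbers. Limits along U of types of tuples of M are realised in M^U, which
    plays the role of compactness of the type spaces, and two points of M^U are
    in the same local component iff their representatives stay at bounded
    distance for the localising metric.

    By uniqueness of the separable local model and omitting types, every tuple
    of M has an isolated type, and a back-and-forth then shows that tuples with
    close types are close up to Aut(M). If P is uniformly continuous and
    properly invariant, and a_k, b_k are tuples whose types converge to the same
    type, cut their limit in M^U into local components: up to a small error a_k
    and b_k are translates of one tuple x of M by automorphisms drifting apart,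
    one per component, and proper invariance along the interleaved sequence
    makes P(a_k) and P(b_k) converge to the same limit. So P extends
    continuously to the type space.

    Conversely, if P is definable, then uniform continuity is a statement about
    equal points of M^U. For g_k drifting apart, the tuple [g_k x] of M^U
    consists of copies of the classes of x in distinct components; since a map
    that is elementary on components and injective on them is elementary, its
    type does not depend on the sequence, so that tp(g_k x) converges. *)

Require Import Defs.
From mathcomp Require Import all_boot all_order all_algebra.
From mathcomp Require Import generic_quotient.
From mathcomp Require Import all_classical all_reals all_analysis.
From mathcomp Require Import ring lra zify.
(* [eval] of [Defs] takes precedence over that of MathComp-Analysis. *)
Import Defs.
Set Implicit Arguments.
Unset Strict Implicit.
Unset Printing Implicit Defensive.
Import Order.TTheory GRing.Theory Num.Theory.
Import numFieldNormedType.Exports.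
Local Open Scope classical_set_scope.
Local Open Scope ring_scope.

(** Categoricity only speaks of separable local models, whereas [M^U] is in general neither
    separable nor local. Hence uses of categoricity in [M^U] pass through separable elementary
    submodels, whose local components are copies of [M]. Homogeneity of [M] cannot be exact: in the
    metric setting, equality of types gives conjugacy only up to an arbitrary error, so isolation,
    closeness of types and back-and-forth all carry explicit errors. Another obstacle is that open
    conditions on tuples are stable under projection but not under complement; they are written
    [cval phi a < 0], evaluated in [M] itself, and complemented only after giving up a margin.
    Sequences and one ultrafilter on the natural numbers suffice because a separable language makes
    the type spaces first countable. Extended real values are read through [contract], which turns
    estimates into real arithmetic. *)

Section ContractedLimits.
Variable R : realType.

Lemma ltr_dist_add (d1 d2 x y z e : R) :
  `|x - y| < d1 -> `|y - z| < d2 -> d1 + d2 <= e -> `|x - z| < e.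
Proof.
rewrite !ltr_norml => /andP[? ?] /andP[? ?] ?; apply/andP; split; lra.
Qed.

Lemma cvg_contractP T (F : set_system T) {FF : Filter F} (f : T -> \bar R) l :
  f @ F --> l <->
  forall e : R, 0 < e -> \forall k \near F, `|contract (f k) - contract l| < e.
Proof.
split=> [/cvg_ballP fl e e0|fl].
  by move/(_ e e0): fl; apply: filterS => k; rewrite /ball/= distrC.
by apply/cvg_ballP => e /fl; apply: filterS => k; rewrite /ball/= distrC.
Qed.

Lemma ultra_cvg_compact T (U : set_system T) {UU : UltraFilter U}
    (K : topologicalType) (A : set K) (f : T -> K) :
  compact A -> (forall t, A (f t)) -> exists2 l, A l & f @ U --> l.
Proof.
move=> cA fA; have [l [Al cl]] := cA (f @ U) _ (@filterE _ U _ (f @^-1` A) fA).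
exists l => // V Vl; have [//|nV] := in_ultra_setVsetC (f @^-1` V) UU.
by have [x [/= nVx Vx]] := cl (~` V) V nV Vl.
Qed.

Lemma ultra_cvg_ereal T (U : set_system T) {UU : UltraFilter U}
    (f : T -> \bar R) : exists l : \bar R, f @ U --> l.
Proof.
have [t|r] := @ultra_cvg_compact _ U UU _ _ (fun t => contract (f t))
  (@segment_compact R (-1) 1).
  by rewrite /= in_itv/= -ler_norml contract_le1.
rewrite /= in_itv/= -ler_norml => r1 /cvgrPdist_lt fr.
exists (expand r); apply/cvg_contractP => e /fr.
by apply: filterS => k; rewrite expandK// distrC.
Qed.

Lemma ptws_cvgP (I : Type) (V : topologicalType) T (F : set_system T)
    {FF : Filter F} (f : T -> {ptws I -> V}) (l : {ptws I -> V}) :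
  f @ F --> l <-> forall i, (fun t => f t i) @ F --> l i.
Proof.
rewrite cvg_sup; split=> fl i W.
  move=> Wl; have : nbhs (l : initial_topology (fun g : I -> V => g i))
      ((fun g : I -> V => g i) @^-1` W).
    move: Wl; rewrite (nbhsE (l i)) => -[B [oB Bl] BW].
    rewrite nbhsE; exists ((fun g : I -> V => g i) @^-1` B) => //.
      by split => //; exists B.
    by move=> g /BW.
  by move/fl.
rewrite nbhsE => -[B [[C oC <-] Cl] CW].
have /fl flC : nbhs (l i) C by exact: open_nbhs_nbhs.
by apply: (@filterS _ F _ _ _ _ flC) => t Ct; exact: CW.
Qed.

Lemma free_ultrafilter : exists2 U : set_system nat, UltraFilter U & \oo `<=` U.
Proof. by have [U [UU oU]] := ultraFilterLemma eventually_filter; exists U. Qed.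

Lemma ultra_cvg_unique T (U : set_system T) {UU : UltraFilter U} (f : T -> \bar R)
    (l l' : \bar R) : f @ U --> l -> f @ U --> l' -> l = l'.
Proof. exact: (@cvg_unique _ (@ereal_hausdorff R)). Qed.

Lemma inv_nat_lt (e : R) : 0 < e -> \forall k \near \oo, k.+1%:R^-1 < e.
Proof.
move=> e0; have := @cvg_harmonic R; move=> /cvgrPdist_lt /(_ e e0).
by apply: filterS => k; rewrite sub0r normrN ger0_norm//= invr_ge0.
Qed.

(** Heine's theorem on a compact power of [\bar R]: counterexamples at the scales [j.+1%:R^-1] would
    have a common limit along [U], where continuity of [c] makes the two values agree. *)
Lemma connective_uc k (c : {ptws 'I_k -> \bar R} -> \bar R) (e : R) :
  continuous c -> 0 < e -> exists2 delta : R, 0 < delta &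
    forall v w : 'I_k -> \bar R,
      (forall i, `|contract (v i) - contract (w i)| < delta) ->
      `|contract (c v) - contract (c w)| < e.
Proof.
move=> cc e0; apply: contrapT => nd.
have [U UU oU] := free_ultrafilter.
have /choice[vw vwP] : forall j : nat,
    exists vw : {ptws 'I_k -> \bar R} * {ptws 'I_k -> \bar R},
    (forall i, `|contract (vw.1 i) - contract (vw.2 i)| < j.+1%:R^-1) /\
    e <= `|contract (c vw.1) - contract (c vw.2)|.
  move=> j; apply: contrapT => nvw; apply: nd; exists j.+1%:R^-1 => // v w vw.
  by rewrite ltNge; apply/negP => evw; apply: nvw; exists (v, w).
have /choice[l lP] : forall i, exists l : \bar R, (fun j => (vw j).1 i) @ U --> l.
  by move=> i; exact: ultra_cvg_ereal.
have vl : (fun j => (vw j).1) @ U --> (l : {ptws 'I_k -> \bar R}).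
  by apply/ptws_cvgP.
have wl : (fun j => (vw j).2) @ U --> (l : {ptws 'I_k -> \bar R}).
  apply/ptws_cvgP => i; apply/cvg_contractP => r r0.
  have r20 : 0 < r / 2 by exact: divr_gt0.
  have /cvg_contractP /(_ _ r20) := lP i; have := oU _ (inv_nat_lt r20).
  apply: filterS2 => j jr vjl.
  have := (vwP j).1 i; rewrite distrC => /ltr_dist_add; apply; first exact: vjl.
  by rewrite [leRHS](splitr r) lerD2r ltW.
have e20 : 0 < e / 2 by exact: divr_gt0.
have /cvg_contractP /(_ _ e20) vc := cvg_comp _ _ vl (cc l).
have /cvg_contractP /(_ _ e20) wc := cvg_comp _ _ wl (cc l).
have [j []] := filter_ex (filterI vc wc).
rewrite /= !ltr_norml => /andP[? ?] /andP[? ?].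
by have := (vwP j).2; rewrite leNgt ltr_norml => /negP; apply; apply/andP; split; lra.
Qed.

Lemma ereal_between (x y : \bar R) : (x < y)%E -> exists r, (x < r < y)%E.
Proof.
rewrite -lt_contract => xy; exists (expand ((contract x + contract y) / 2)).
have := contract_le1 x; have := contract_le1 y; rewrite !ler_norml.
move=> /andP[? ?] /andP[? ?]; rewrite -!lt_contract expandK ?inE ?ler_norml;
  by apply/andP; split; lra.
Qed.

Lemma contract_inf_ge (S : set (\bar R)) (r : R) : S !=set0 ->
  (forall y, S y -> r <= contract y) -> r <= contract (ereal_inf S).
Proof.
move=> S0 Sr; rewrite contract_inf//; apply: lb_le_inf.
  by have [y Sy] := S0; exists (contract y); exists y.
by move=> _ [y Sy <-]; exact: Sr.
Qed.

Lemma contract_sup_le (S : set (\bar R)) (r : R) : S !=set0 ->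
  (forall y, S y -> contract y <= r) -> contract (ereal_sup S) <= r.
Proof.
move=> S0 Sr; rewrite contract_sup//; apply: ge_sup.
  by have [y Sy] := S0; exists (contract y); exists y.
by move=> _ [y Sy <-]; exact: Sr.
Qed.

Lemma contract_inf_lt (S : set (\bar R)) (r : R) : S !=set0 ->
  contract (ereal_inf S) < r -> exists2 y, S y & contract y < r.
Proof.
move=> S0; rewrite ltNge => /negP nr; apply: contrapT => nS; apply: nr.
apply: contract_inf_ge => // y Sy; rewrite leNgt; apply/negP => yr.
by apply: nS; exists y.
Qed.

Lemma contract_inf_le (S : set (\bar R)) y : S y ->
  contract (ereal_inf S) <= contract y.
Proof. by move=> Sy; rewrite le_contract; exact: ereal_inf_lbound. Qed.

Lemma contract_sup_ge (S : set (\bar R)) y : S y ->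
  contract y <= contract (ereal_sup S).
Proof. by move=> Sy; rewrite le_contract; exact: ereal_sup_ubound. Qed.

End ContractedLimits.

(** * Formulas and elementary maps *)

Section Formulas.
Variables (R : realType) (L : language R).
Implicit Types (N : mstructure L).

(** [contract] is an order isomorphism onto [-1, 1], so that order and uniform continuity of values
    become ordinary real arithmetic. *)
Definition cval N n (phi : formula L n) (a : 'I_n -> N) : R :=
  contract (eval phi a).

Lemma cval_inj N N' n (phi : formula L n) (a : 'I_n -> N) (b : 'I_n -> N') :
  cval phi a = cval phi b -> eval phi a = eval phi b.
Proof. exact: contract_inj. Qed.

Lemma tp_eq N N' n (a : 'I_n -> N) (b : 'I_n -> N') :
  tp a = tp b <-> forall phi : formula L n, eval phi a = eval phi b.
Proof.
split=> [ab phi|ab]; last by apply/funext => phi; exact: ab.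
by have := congr1 (fun p => p phi) ab.
Qed.

Lemma dist_ge0 N (x y : N) : (0 <= dist x y)%E.
Proof. by have [] := dist_gen_metric N. Qed.

Lemma distxx N (x : N) : dist x x = 0%E.
Proof. by have [_ /(_ x x)[_ ->]] := dist_gen_metric N. Qed.

Lemma dist_eq0 N (x y : N) : dist x y = 0%E -> x = y.
Proof. by have [_ /(_ x y)[+ _]] := dist_gen_metric N. Qed.

Lemma distC N (x y : N) : dist x y = dist y x.
Proof. by have [_ _ ->] := dist_gen_metric N. Qed.

Lemma dist_tri N (x y z : N) : (dist x z <= dist x y + dist y z)%E.
Proof. by have [_ _ _] := dist_gen_metric N. Qed.

Lemma dist_lt_tri N (y x z : N) (e1 e2 : R) :
  (dist x y < e1%:E)%E -> (dist y z < e2%:E)%E -> (dist x z < (e1 + e2)%:E)%E.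
Proof.
move=> xy yz; apply: le_lt_trans (dist_tri x y z) _.
by rewrite EFinD; exact: lteD.
Qed.

Lemma dist_lt_split N (y x z : N) (e : R) :
  (dist x y < (e / 2)%:E)%E -> (dist y z < (e / 2)%:E)%E -> (dist x z < e%:E)%E.
Proof. by move=> xy yz; rewrite (splitr e); exact: dist_lt_tri xy yz. Qed.

Lemma max_dist_ltP (X : Type) (d : X -> X -> \bar R) n (a b : 'I_n -> X) (e : R) :
  0 < e -> (max_dist d a b < e%:E)%E <-> forall i, (d (a i) (b i) < e%:E)%E.
Proof.
move=> e0; rewrite /max_dist; split => [/bigmax_ltP[_ ab] i|ab].
  exact: ab.
by apply/bigmax_ltP; split; rewrite ?lte_fin.
Qed.

Fixpoint term_rename n m (s : 'I_n -> 'I_m) (t : term L n) : term L m :=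
  match t with
  | TVar i => TVar L (s i)
  | TApp f u => TApp (fun j => term_rename s (u j))
  end.

Lemma teval_rename N n m (s : 'I_n -> 'I_m) (t : term L n) (a : 'I_m -> N) :
  teval a (term_rename s t) = teval (a \o s) t.
Proof. by elim: t => //= f u IH; congr fun_interp; apply/funext. Qed.

Definition lift_rename n m (s : 'I_n -> 'I_m) (i : 'I_n.+1) : 'I_m.+1 :=
  if unlift ord0 i is Some j then lift ord0 (s j) else ord0.

Lemma tcons_rename (X : Type) n m (s : 'I_n -> 'I_m) x (a : 'I_m -> X) :
  tcons x a \o lift_rename s = tcons x (a \o s).
Proof.
apply/funext => i; rewrite /tcons /lift_rename/=.
by case: (unliftP ord0 i) => [j|] _; rewrite ?liftK ?unlift_none.
Qed.

Fixpoint formula_rename n (phi : formula L n) : forall m, ('I_n -> 'I_m) -> formula L m :=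
  match phi in formula _ k return forall m, ('I_k -> 'I_m) -> formula L m with
  | FDist _ t u => fun m s => FDist (term_rename s t) (term_rename s u)
  | FRel _ r t => fun m s => FRel (fun j => term_rename s (t j))
  | FConn _ _ c cc psi => fun m s => FConn cc (fun j => formula_rename (psi j) s)
  | FSup _ psi => fun m s => FSup (formula_rename psi (lift_rename s))
  | FInf _ psi => fun m s => FInf (formula_rename psi (lift_rename s))
  end.

Lemma eval_rename N n (phi : formula L n) m (s : 'I_n -> 'I_m) (a : 'I_m -> N) :
  eval (formula_rename phi s) a = eval phi (a \o s).
Proof.
elim: phi m s a => {n} [n t u|n r t|n k c cc psi IH|n psi IH|n psi IH] m s a /=.
- by rewrite !teval_rename.
- by congr rel_interp; apply/funext => j; rewrite teval_rename.
- by congr c; apply/funext => j; rewrite IH.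
- congr ereal_sup; apply: eq_imagel => x _; by rewrite IH tcons_rename.
- congr ereal_inf; apply: eq_imagel => x _; by rewrite IH tcons_rename.
Qed.

Lemma common_delta (I : finType) (P : I -> R -> Prop) :
  (forall i d d', d <= d' -> P i d' -> P i d) ->
  (forall i, exists2 d, 0 < d & P i d) ->
  exists2 d, 0 < d & forall i, P i d.
Proof.
move=> Pm /(_ _)/cid2-/all_sig2[d d0 Pd].
exists (\big[Num.min/1]_i d i); first by apply: lt_bigmin.
by move=> i; apply: Pm (Pd i); exact: bigmin_le_cond.
Qed.

Lemma term_uc n (t : term L n) (e : R) : 0 < e ->
  exists2 delta : R, 0 < delta & forall N (a b : 'I_n -> N),
    (forall i, (dist (a i) (b i) < delta%:E)%E) ->
    (dist (teval a t) (teval b t) < e%:E)%E.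
Proof.
elim: t e => [i|f u IH] e e0; first by exists e => // N a b; exact.
have e20 : 0 < e / 2 by exact: divr_gt0.
have m0 := fun_mod_gt0 f e20.
have [|j|d d0 dP] := @common_delta _ (fun j d => forall N (a b : 'I_n -> N),
    (forall i, (dist (a i) (b i) < d%:E)%E) ->
    (dist (teval a (u j)) (teval b (u j)) < (fun_mod f (e / 2))%:E)%E).
- move=> j d d' dd' + N a b ab; apply => i.
  by apply: lt_le_trans (ab i) _; rewrite lee_fin.
- exact: IH.
exists d => // N a b ab /=.
apply: (@le_lt_trans _ _ (e / 2)%:E); last by rewrite lte_fin gtr_pMr// invf_lt1// ltr1n.
by apply: fun_interp_uc => //; apply/max_dist_ltP => // j; exact: dP.
Qed.

Lemma contract_lip (x y : R) : 0 <= x -> x <= y ->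
  contract y%:E - contract x%:E <= y - x.
Proof.
move=> x0 xy /=; have y0 := le_trans x0 xy; rewrite !ger0_norm//.
have x1 : 0 < 1 + x by lra.
have y1 : 0 < 1 + y by lra.
have -> : y / (1 + y) - x / (1 + x) = (y - x) * ((1 + x) * (1 + y))^-1.
  by field; rewrite !gt_eqF.
rewrite ler_piMr ?subr_ge0// invf_le1 ?mulr_gt0//; nra.
Qed.

(** Between finite distances this is the triangle inequality, [contract] being 1-Lipschitz there.
    Moving points by finite amounts cannot change whether a distance is infinite, so the only other
    case is equality at +oo. *)
Lemma dist_contract_uc (e : R) : 0 < e -> exists2 delta : R, 0 < delta &
  forall N (x y x' y' : N), (dist x x' < delta%:E)%E -> (dist y y' < delta%:E)%E ->
  `|contract (dist x y) - contract (dist x' y')| < e.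
Proof.
move=> e0; have e20 : 0 < e / 2 by exact: divr_gt0.
have half N (x y x' y' : N) : (dist x x' < (e / 2)%:E)%E ->
    (dist y y' < (e / 2)%:E)%E -> contract (dist x y) - contract (dist x' y') < e.
  move=> xx yy.
  have xy : (dist x y <= (dist x' y' + (dist x x' + dist y y')))%E.
    rewrite addeCA; apply: le_trans (dist_tri x x' y) _.
    by rewrite leeD2l// (distC y y') dist_tri.
  have [xy'|/ltW] := leP (dist x y) (dist x' y').
    by rewrite (le_lt_trans _ e0)// subr_le0 le_contract.
  have := dist_ge0 x y; have := dist_ge0 x' y'.
  have := dist_ge0 x x'; have := dist_ge0 y y'.
  move: xx yy xy.
  move: (dist x x') (dist y y') (dist x y) (dist x' y') => [a| |] [b| |] [c| |] [d| |] //.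
    rewrite !lte_fin !lee_fin => ae be cab b0 a0 d0 c0 dc.
    by apply: le_lt_trans (contract_lip d0 dc) _; lra.
  by move=> _ _ _ _ _ _ _ _; rewrite subrr.
exists (e / 2) => // N x y x' y' xx yy; rewrite ltr_norml ltrNl opprB.
by rewrite !half// distC.
Qed.

Lemma dist_tcons N n (a b : 'I_n -> N) x (d : R) : 0 < d ->
  (forall i, (dist (a i) (b i) < d%:E)%E) ->
  forall i, (dist (tcons x a i) (tcons x b i) < d%:E)%E.
Proof.
move=> d0 ab i; rewrite /tcons; case: unliftP => [j _|_]; first exact: ab.
by rewrite distxx lte_fin.
Qed.

Lemma cval_uc n (phi : formula L n) (e : R) : 0 < e ->
  exists2 delta : R, 0 < delta & forall N (a b : 'I_n -> N),
    (forall i, (dist (a i) (b i) < delta%:E)%E) -> `|cval phi a - cval phi b| < e.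
Proof.
rewrite /cval.
elim: phi e => {n} [n t u|n r t|n k c cc psi IH|n psi IH|n psi IH] e e0.
- have [d d0 dP] := dist_contract_uc e0.
  have [d1 d10 d1P] := term_uc t d0; have [d2 d20 d2P] := term_uc u d0.
  exists (Num.min d1 d2); first by rewrite lt_min d10.
  move=> N a b ab; apply: dP; [apply: d1P|apply: d2P] => i;
    by apply: lt_le_trans (ab i) _; rewrite lee_fin ge_min lexx ?orbT.
- have e20 : 0 < e / 2 by exact: divr_gt0.
  have m0 := rel_mod_gt0 r e20.
  have [|j|d d0 dP] := @common_delta _ (fun j d => forall N (a b : 'I_n -> N),
    (forall i, (dist (a i) (b i) < d%:E)%E) ->
    (dist (teval a (t j)) (teval b (t j)) < (rel_mod r (e / 2))%:E)%E).
  + move=> j d d' dd' + N a b ab; apply => i.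
    by apply: lt_le_trans (ab i) _; rewrite lee_fin.
  + exact: term_uc.
  exists d => // N a b ab /=.
  apply: (@le_lt_trans _ _ (e / 2)); last by rewrite gtr_pMr// invf_lt1// ltr1n.
  by apply: rel_interp_uc => //; apply/max_dist_ltP => // j; exact: dP.
- have [d' d'0 d'P] := connective_uc cc e0.
  have [|j|d d0 dP] := @common_delta _ (fun j d => forall N (a b : 'I_n -> N),
    (forall i, (dist (a i) (b i) < d%:E)%E) ->
    `|contract (eval (psi j) a) - contract (eval (psi j) b)| < d').
  + move=> j x y xy + N a b ab; apply => i.
    by apply: lt_le_trans (ab i) _; rewrite lee_fin.
  + exact: IH.
  by exists d => // N a b ab /=; apply: d'P => j; exact: dP.
(* A supremum only preserves weak inequalities; starting from [e / 2] restores the strict one. *)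
- have e20 : 0 < e / 2 by exact: divr_gt0.
  have [d d0 dP] := IH _ e20; exists d => // N a b ab.
  have H (a' b' : 'I_n -> N) : (forall i, (dist (a' i) (b' i) < d%:E)%E) ->
      contract (eval (FSup psi) a') <= contract (eval (FSup psi) b') + e / 2.
    move=> ab'; have [x0] := carrier_inhabited N.
    apply: contract_sup_le; first by exists (eval psi (tcons x0 a')); exists x0.
    move=> _ [x _ <-].
    have /ltW := dP _ (tcons x a') (tcons x b') (dist_tcons x d0 ab').
    rewrite ler_distl => /andP[_] /le_trans; apply.
    by rewrite lerD2r; apply: contract_sup_ge; exists x.
  apply: (@le_lt_trans _ _ (e / 2)); last by rewrite gtr_pMr// invf_lt1// ltr1n.
  rewrite ler_distl H//= andbT lerBlDr; apply: H => i.
  by rewrite distC.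
- have e20 : 0 < e / 2 by exact: divr_gt0.
  have [d d0 dP] := IH _ e20; exists d => // N a b ab.
  have H (a' b' : 'I_n -> N) : (forall i, (dist (a' i) (b' i) < d%:E)%E) ->
      contract (eval (FInf psi) a') - e / 2 <= contract (eval (FInf psi) b').
    move=> ab'; have [x0] := carrier_inhabited N.
    apply: contract_inf_ge; first by exists (eval psi (tcons x0 b')); exists x0.
    move=> _ [x _ <-].
    have /ltW := dP _ (tcons x a') (tcons x b') (dist_tcons x d0 ab').
    rewrite ler_distl => /andP[_ h]; rewrite lerBlDr; apply: le_trans h.
    by apply: contract_inf_le; exists x.
  apply: (@le_lt_trans _ _ (e / 2)); last by rewrite gtr_pMr// invf_lt1// ltr1n.
  rewrite ler_distl; apply/andP; split; last by rewrite -lerBlDr; exact: H.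
  by apply: H => i; rewrite distC.
Qed.

Lemma eval_tcons_inf N n (psi : formula L n.+1) (a : 'I_n -> N) x :
  cval (FInf psi) a <= cval psi (tcons x a).
Proof. by apply: contract_inf_le; exists x. Qed.

(** An infimum need not be attained, but a strict upper bound on it is witnessed. This is why open
    conditions, written as strict inequalities, are stable under projection. *)
Lemma cval_inf_lt N n (psi : formula L n.+1) (a : 'I_n -> N) (r : R) :
  cval (FInf psi) a < r <-> exists x, cval psi (tcons x a) < r.
Proof.
split=> [|[x]]; last by apply: le_lt_trans; exact: eval_tcons_inf.
have [x0] := carrier_inhabited N.
move/contract_inf_lt => []; first by exists (eval psi (tcons x0 a)); exists x0.
by move=> _ [x _ <-] xr; exists x.
Qed.

Lemma tcons_comp (X Y : Type) (f : X -> Y) n x (a : 'I_n -> X) :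
  f \o tcons x a = tcons (f x) (f \o a).
Proof. by apply/funext => i; rewrite /tcons/=; case: unliftP. Qed.

Lemma elementary_tp N N' (f : N -> N') n (a : 'I_n -> N) : elementary f ->
  tp (f \o a) = tp a.
Proof. by move=> ef; apply/tp_eq => phi; exact: ef. Qed.

Lemma elementary_comp N N' N'' (f : N -> N') (g : N' -> N'') :
  elementary f -> elementary g -> elementary (g \o f).
Proof. by move=> ef eg n phi a; rewrite -compA eg ef. Qed.

Lemma comp_pair2 (X Y : Type) (f : X -> Y) x y :
  f \o pair2 x y = pair2 (f x) (f y).
Proof.
by apply/funext => -[[|[|//]] i]; rewrite /pair2/= !(tnth_nth (f x), tnth_nth x).
Qed.

Lemma elementary_dist N N' (f : N -> N') x y : elementary f ->
  dist (f x) (f y) = dist x y.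
Proof.
move=> ef.
exact: (ef _ (FDist (TVar L (ord0 : 'I_2)) (TVar L (lift ord0 ord0))) (pair2 x y)).
Qed.

Lemma elementary_inj N N' (f : N -> N') : elementary f -> injective f.
Proof.
by move=> ef x y fxy; apply: dist_eq0; rewrite -(elementary_dist _ _ ef) fxy distxx.
Qed.

Lemma elementary_Th N N' (f : N -> N') (T : theory L) : elementary f ->
  model T N <-> model T N'.
Proof.
move=> ef; split=> mN phi Tphi a; last by rewrite -(ef _ phi) mN.
have [x0] := carrier_inhabited N.
rewrite -(mN _ Tphi (fun=> x0)) -(ef _ phi); congr eval.
by apply/funext => -[].
Qed.

Lemma Th_model N : model (Th N) N.
Proof. by move=> phi; apply. Qed.

Lemma isomorphism_teval N N' (f : N -> N') n (t : term L n) a :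
  isomorphism f -> teval (f \o a) t = f (teval a t).
Proof.
move=> [_ _ ff _]; elim: t => //= s u IH.
by rewrite ff; congr fun_interp; apply/funext => j; exact: IH.
Qed.

Lemma isomorphism_elementary N N' (f : N -> N') : isomorphism f -> elementary f.
Proof.
move=> isof; have [[g fK gK] df ff rf] := isof.
move=> n; elim=> {n} [n t u|n r t|n k c cc psi IH|n psi IH|n psi IH] a /=.
- by rewrite !isomorphism_teval.
- by rewrite -rf; congr rel_interp; apply/funext => j; exact: isomorphism_teval.
- by congr c; apply/funext => j; exact: IH.
- congr ereal_sup; apply/seteqP; split=> _ [x _ <-] /=.
    by exists (g x) => //; rewrite -IH tcons_comp gK.
  by exists (f x) => //; rewrite -tcons_comp IH.
- congr ereal_inf; apply/seteqP; split=> _ [x _ <-] /=.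
    by exists (g x) => //; rewrite -IH tcons_comp gK.
  by exists (f x) => //; rewrite -tcons_comp IH.
Qed.

End Formulas.

(** * Limits of extended reals along an ultrafilter *)

Section Ultralimits.
Variables (R : realType) (U : set_system nat).
Context {UU : UltraFilter U}.
Implicit Types (u v : nat -> \bar R).

Definition ulim u : \bar R := projT1 (cid (@ultra_cvg_ereal R _ U _ u)).

Lemma ulim_cvg u : u @ U --> ulim u.
Proof. exact: projT2 (cid (@ultra_cvg_ereal R _ U _ u)). Qed.

Lemma ulim_contract u (e : R) : 0 < e ->
  \forall k \near U, `|contract (u k) - contract (ulim u)| < e.
Proof. by have /cvg_contractP := @ulim_cvg u; apply. Qed.

Lemma ulim_eqP u (l : \bar R) : ulim u = l <-> u @ U --> l.
Proof.
split=> [<-|ul]; first exact: ulim_cvg.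
exact: ultra_cvg_unique (ulim_cvg (u:=u)) ul.
Qed.

Lemma ulim_near_eq u v :
  (forall e : R, 0 < e -> \forall k \near U, `|contract (u k) - contract (v k)| < e) ->
  ulim u = ulim v.
Proof.
move=> uv; apply/ulim_eqP/cvg_contractP => e e0.
have e20 : 0 < e / 2 by exact: divr_gt0.
have := ulim_contract v e20; apply: filterS2 (uv _ e20) => k uvk vk.
by apply: ltr_dist_add uvk vk _; rewrite -splitr.
Qed.

Lemma ulim_le u v : (\forall k \near U, (u k <= v k)%E) -> (ulim u <= ulim v)%E.
Proof.
move=> uv; rewrite leNgt -lt_contract; apply/negP => vu.
have e0 : 0 < (contract (ulim u) - contract (ulim v)) / 2 by lra.
have [k [[]]] := filter_ex (filterI (filterI (ulim_contract u e0) (ulim_contract v e0)) uv).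
rewrite -le_contract !ltr_norml => /andP[? ?] /andP[? ?] ?; lra.
Qed.

Lemma ulim_cst (x : \bar R) : ulim (fun=> x) = x.
Proof. by apply/ulim_eqP; exact: cvg_cst. Qed.

Lemma ulim_lt u (x : \bar R) : (ulim u < x)%E -> \forall k \near U, (u k < x)%E.
Proof.
rewrite -lt_contract => ux.
have e0 : 0 < (contract x - contract (ulim u)) by lra.
apply: filterS (ulim_contract u e0) => k; rewrite -lt_contract ltr_norml => /andP[? ?].
lra.
Qed.

Lemma ulim_gt u (x : \bar R) : (x < ulim u)%E -> \forall k \near U, (x < u k)%E.
Proof.
rewrite -lt_contract => ux.
have e0 : 0 < (contract (ulim u) - contract x) by lra.
apply: filterS (ulim_contract u e0) => k; rewrite -lt_contract ltr_norml => /andP[? ?].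
lra.
Qed.

End Ultralimits.
Arguments ulim {R} U {UU} u.
Arguments ulim_cst {R} U {UU} x.

Lemma near_forall_fin (T : Type) (U : set_system T) {FU : Filter U} (I : finType)
    (P : I -> T -> Prop) :
  (forall i, \forall k \near U, P i k) -> \forall k \near U, forall i, P i k.
Proof. exact: filter_forall. Qed.

(** The choice is made from the predicate [E x], which is the same for all members of a class, and
    proof irrelevance makes equal predicates give equal choices. Used for points of ultrapowers and
    for local components. *)
Lemma equivalence_section (X : Type) (E : X -> X -> Prop) :
  (forall x, E x x) -> (forall x y, E x y -> E y x) ->
  (forall x y z, E x y -> E y z -> E x z) ->
  exists r : X -> X, (forall x, E x (r x)) /\ forall x y, E x y -> r x = r y.
Proof.
move=> Er Es Et; pose ex x : exists y, E x y := ex_intro _ x (Er x).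
exists (fun x => projT1 (cid (ex x))); split=> [x|x y xy].
  exact: projT2 (cid (ex x)).
have ExE : E x = E y.
  by apply/funext => z; apply/propext; split; apply: Et => //; exact: Es.
by move: (ex x) (ex y); rewrite ExE => p q; rewrite (Prop_irrelevance p q).
Qed.

(** * Ultrapowers *)

Section Ultrapower.
Variables (R : realType) (L : language R) (U : set_system nat).
Context {UU : UltraFilter U}.
Hypothesis oU : \oo `<=` U.
Variable N : mstructure L.
Implicit Types (a b c : nat -> N).

Definition ueq a b := forall e : R, 0 < e ->
  \forall k \near U, (dist (a k) (b k) < e%:E)%E.

Lemma ueq_refl a : ueq a a.
Proof. by move=> e e0; apply: nearW => k; rewrite distxx lte_fin. Qed.

Lemma ueq_sym a b : ueq a b -> ueq b a.
Proof. by move=> ab e /ab; apply: filterS => k; rewrite distC. Qed.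

Lemma ueq_trans a b c : ueq a b -> ueq b c -> ueq a c.
Proof.
move=> ab bc e e0; have e20 : 0 < e / 2 by exact: divr_gt0.
by apply: filterS2 (ab _ e20) (bc _ e20) => k; exact: dist_lt_split.
Qed.

Lemma ueq_ulim_dist a b : ueq a b <-> ulim U (fun k => dist (a k) (b k)) = 0%E.
Proof.
split=> [ab|ab0 e e0]; last by apply: ulim_lt; rewrite ab0 lte_fin.
apply/eqP; rewrite eq_le; apply/andP; split; last first.
  rewrite -[leLHS](ulim_cst U); apply: ulim_le; apply: nearW => k.
  exact: dist_ge0.
apply/lee_addgt0Pr => e /ab abe; rewrite add0e -(ulim_cst U (e%:E)).
by apply: ulim_le; apply: filterS abe => k /ltW.
Qed.

Definition urep : (nat -> N) -> nat -> N :=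
  projT1 (cid (equivalence_section ueq_refl ueq_sym ueq_trans)).

Lemma urepP : (forall a, ueq a (urep a)) /\ forall a b, ueq a b -> urep a = urep b.
Proof. exact: projT2 (cid (equivalence_section ueq_refl ueq_sym ueq_trans)). Qed.

Lemma urep_ueq a : ueq a (urep a).
Proof. exact: urepP.1. Qed.

Lemma urep_eq a b : ueq a b -> urep a = urep b.
Proof. exact: urepP.2. Qed.

(** The quotient by [ueq] is carried by chosen representatives, so that every point comes with a
    sequence. *)
Definition upow := {a | urep a = a}.

Definition ucl a : upow := exist _ (urep a) (esym (urep_eq (urep_ueq a))).

Lemma ucl_ueq a : ueq (sval (ucl a)) a.
Proof. exact/ueq_sym/urep_ueq. Qed.

Lemma ucl_eqP a b : ucl a = ucl b <-> ueq a b.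
Proof.
split=> [/(congr1 sval)/= ab|ab]; last by apply: eq_exist; exact: urep_eq.
by apply: ueq_trans (urep_ueq a) _; rewrite ab; exact/ueq_sym/urep_ueq.
Qed.

Lemma uclK (x : upow) : ucl (sval x) = x.
Proof. by case: x => a aP; apply: eq_exist. Qed.

Definition udist (x y : upow) := ulim U (fun k => dist (sval x k) (sval y k)).

Lemma ulim_dist_ueq a a' b b' : ueq a a' -> ueq b b' ->
  ulim U (fun k => dist (a k) (b k)) = ulim U (fun k => dist (a' k) (b' k)).
Proof.
move=> aa bb; apply: ulim_near_eq => e /(dist_contract_uc L)[d d0 dP].
by apply: filterS2 (aa _ d0) (bb _ d0) => k; exact: dP.
Qed.

Lemma udist_ucl a b : udist (ucl a) (ucl b) = ulim U (fun k => dist (a k) (b k)).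
Proof. by apply: ulim_dist_ueq; exact: ucl_ueq. Qed.

Lemma udist_gen_metric : gen_metric udist.
Proof.
split.
- move=> x y; rewrite -[leLHS](ulim_cst U); apply: ulim_le; apply: nearW => k.
  exact: dist_ge0.
- move=> x y; rewrite -(uclK x) -(uclK y) udist_ucl ucl_eqP.
  by split => /ueq_ulim_dist.
- by move=> x y; congr (ulim U); apply/funext => k; exact: distC.
- have u0 x y : (0 <= udist x y)%E.
    by rewrite -[leLHS](ulim_cst U); apply: ulim_le; apply: nearW => k;
      exact: dist_ge0.
  move=> x y z; have := u0 x y; have := u0 y z.
  case xy: (udist x y) => [p| |] //; case yz: (udist y z) => [q| |] // _ _;
    do ?exact: leey.
  apply/lee_addgt0Pr => e e0; have e20 : 0 < e / 2 by exact: divr_gt0.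
  have xyk : \forall k \near U, (dist (sval x k) (sval y k) < (p + e / 2)%:E)%E.
    by apply: ulim_lt; rewrite -/(udist x y) xy lte_fin ltrDl.
  have yzk : \forall k \near U, (dist (sval y k) (sval z k) < (q + e / 2)%:E)%E.
    by apply: ulim_lt; rewrite -/(udist y z) yz lte_fin ltrDl.
  rewrite -[leRHS](ulim_cst U); apply: ulim_le.
  apply: filterS2 xyk yzk => k xyk yzk; apply/ltW.
  apply: lt_le_trans (dist_lt_tri xyk yzk) _.
  by rewrite -EFinD lee_fin; lra.
Qed.

(** Diagonal argument: along a fast subsequence, coordinate [k] uses the largest stage [ix k] up to
    which the representatives satisfy, at [k], the estimates known in the limit. *)
Lemma udist_complete : complete_metric udist.
Proof.
move=> x xC.
have /choice[m mP] : forall i : nat, exists m : nat, forall j k : nat,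
  (m <= j)%N -> (m <= k)%N -> (udist (x j) (x k) < (i.+1%:R^-1)%:E)%E.
  by move=> i; apply: xC.
pose y i := sval (x (m i)).
(* The bound [i <= k] ensures that a largest good stage exists; it holds almost everywhere because
   [U] is free. *)
pose good i := [set k | (i <= k)%N /\ forall p q, (p <= i)%N -> (q <= i)%N ->
  (dist (y p k) (y q k) < (p.+1%:R^-1 + q.+1%:R^-1)%:E)%E].
have Ugood i : U (good i).
  apply: filterI; first by apply: oU; exact: nbhs_infty_ge.
  have : \forall k \near U, forall pq : 'I_i.+1 * 'I_i.+1,
      (dist (y pq.1 k) (y pq.2 k) < (pq.1.+1%:R^-1 + pq.2.+1%:R^-1)%:E)%E.
    apply: near_forall_fin => -[p q]/=; apply: ulim_lt.
    have [_ _ _ ut] := udist_gen_metric.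
    apply: le_lt_trans (ut _ (x (maxn (m p) (m q))) _) _; rewrite EFinD lteD//.
      by apply: mP; rewrite // leq_maxl.
    by apply: mP; rewrite // leq_maxr.
  apply: filterS => k h p q pi qi.
  exact: (h (Ordinal (pi : (p < i.+1)%N), Ordinal (qi : (q < i.+1)%N))).
have /choice[ix ixP] : forall k, exists i, forall j, good j k -> (j <= i)%N /\ good i k.
  move=> k; have [[j0 gj0]|ng] := pselect (exists j, good j k); last first.
    by exists 0%N => j gj; case: ng; exists j.
  have ex : exists j, `[< good j k >] by exists j0; apply/asboolP.
  have bd : forall j, `[< good j k >] -> (j <= k)%N by move=> j /asboolP[].
  exists (ex_maxn ex bd) => j gj.
  case: ex_maxnP => i /asboolP gi imax; split => //.
  by apply: imax; apply/asboolP.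
pose z := ucl (fun k => y (ix k) k).
have yz i : (udist (x (m i)) z <= (2 * i.+1%:R^-1)%:E)%E.
  rewrite -(uclK (x (m i))) udist_ucl -(ulim_cst U (_%:E)); apply: ulim_le.
  apply: filterS (Ugood i) => k /(ixP k)[ii [_ /(_ _ _ ii (leqnn _)) /ltW]].
  move/le_trans; apply; rewrite lee_fin mulr_natl mulr2n lerD2l.
  by rewrite lef_pV2 ?posrE// ler_nat.
exists z => e e0; have e30 : 0 < e / 3 by exact: divr_gt0.
have [i ie] : exists i : nat, i.+1%:R^-1 < e / 3.
  by have [i] := filter_ex (inv_nat_lt e30); exists i.
exists (m i) => k mk; have [_ _ _ ut] := udist_gen_metric.
apply: le_lt_trans (ut _ (x (m i)) _) _.
have h : ((i.+1%:R^-1)%:E + (2 * i.+1%:R^-1)%:E < e%:E :> \bar R)%E.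
  rewrite -EFinD lte_fin; set t := _^-1 in ie *; lra.
by apply: le_lt_trans h; apply: leeD => //; apply/ltW; exact: mP.
Qed.

Definition ufun f (x : 'I_(fun_ar f) -> upow) : upow :=
  ucl (fun k => fun_interp N f (fun j => sval (x j) k)).

Definition urel r (x : 'I_(rel_ar r) -> upow) : \bar R :=
  ulim U (fun k => rel_interp N r (fun j => sval (x j) k)).

Lemma near_max_dist n (x y : 'I_n -> upow) (e : R) : 0 < e ->
  (max_dist udist x y < e%:E)%E ->
  \forall k \near U,
    (max_dist dist (fun j => sval (x j) k) (fun j => sval (y j) k) < e%:E)%E.
Proof.
move=> e0 /(max_dist_ltP _ _ _ e0) xy.
have : \forall k \near U, forall j, (dist (sval (x j) k) (sval (y j) k) < e%:E)%E.
  by apply: near_forall_fin => j; apply: ulim_lt; exact: xy.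
by apply: filterS => k h; apply/max_dist_ltP.
Qed.

Lemma ufun_uc f (e : R) (x y : 'I_(fun_ar f) -> upow) : 0 < e ->
  (max_dist udist x y < (fun_mod f e)%:E)%E -> (udist (ufun x) (ufun y) <= e%:E)%E.
Proof.
move=> e0 /(near_max_dist (fun_mod_gt0 f e0)) xy.
rewrite udist_ucl -(ulim_cst U e%:E); apply: ulim_le.
by apply: filterS xy => k; exact: fun_interp_uc.
Qed.

Lemma urel_uc r (e : R) (x y : 'I_(rel_ar r) -> upow) : 0 < e ->
  (max_dist udist x y < (rel_mod r e)%:E)%E ->
  `|contract (urel x) - contract (urel y)| <= e.
Proof.
move=> e0 /(near_max_dist (rel_mod_gt0 r e0)) xy.
apply/ler_addgt0Pr => d d0; have d30 : 0 < d / 3 by exact: divr_gt0.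
have [k [[]]] := filter_ex (filterI (filterI
  (ulim_contract (fun k => rel_interp N r (fun j => sval (x j) k)) d30)
  (ulim_contract (fun k => rel_interp N r (fun j => sval (y j) k)) d30)) xy).
rewrite -/(urel x) -/(urel y) => xk yk /(rel_interp_uc e0).
move: xk yk; rewrite !ltr_norml !ler_norml => /andP[? ?] /andP[? ?] /andP[? ?].
apply/andP; split; lra.
Qed.

Definition ultrapower : mstructure L :=
  @MStructure R L upow (let: inhabits x := carrier_inhabited N in inhabits (ucl (fun=> x)))
    udist udist_gen_metric udist_complete ufun urel ufun_uc urel_uc.

Definition uclass (a : nat -> N) : ultrapower := ucl a.

Definition useq (x : ultrapower) : nat -> N := sval x.

Lemma useqK (x : ultrapower) : uclass (useq x) = x.
Proof. exact: uclK. Qed.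

Lemma uclass_ueq a : ueq (useq (uclass a)) a.
Proof. exact: ucl_ueq. Qed.

Lemma teval_ultrapower n (t : term L n) (x : 'I_n -> ultrapower) :
  ueq (useq (teval x t)) (fun k => teval (fun j => useq (x j) k) t).
Proof.
elim: t => [i|f s IH]; first exact: ueq_refl.
apply: ueq_trans (uclass_ueq _) _ => e e0.
have e20 : 0 < e / 2 by exact: divr_gt0.
have : \forall k \near U, forall j, (dist (useq (teval x (s j)) k)
    (teval (fun i => useq (x i) k) (s j)) < (fun_mod f (e / 2))%:E)%E.
  by apply: near_forall_fin => j; apply: IH; exact: fun_mod_gt0.
apply: filterS => k h; apply: (@le_lt_trans _ _ (e / 2)%:E).
  by apply: fun_interp_uc => //; apply/max_dist_ltP => //; exact: fun_mod_gt0.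
by rewrite lte_fin gtr_pMr// invf_lt1// ltr1n.
Qed.

Lemma useq_tcons n (y : ultrapower) (x : 'I_n -> ultrapower) k :
  (fun j => useq (tcons y x j) k) = tcons (useq y k) (fun j => useq (x j) k).
Proof. by apply/funext => j; rewrite /tcons; case: unliftP. Qed.

Lemma ulim_tcons n (psi : formula L n.+1) (y : nat -> N) (x : 'I_n -> ultrapower) :
  ulim U (fun k => eval psi (fun j => useq (tcons (uclass y) x j) k)) =
  ulim U (fun k => eval psi (tcons (y k) (fun j => useq (x j) k))).
Proof.
apply: ulim_near_eq => e /(cval_uc psi)[d d0 dP].
apply: filterS (uclass_ueq y d0) => k yk; apply: dP => i.
by rewrite /tcons; case: unliftP => [j _|_//]; rewrite distxx lte_fin.
Qed.

(** In the quantifier cases, a value [r] strictly between the two sides would allow witnesses beyond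
    [r] to be chosen in almost every coordinate, and their class would be a witness in the
    ultrapower. *)
Lemma Los_useq n (phi : formula L n) (x : 'I_n -> ultrapower) :
  eval phi x = ulim U (fun k => eval phi (fun j => useq (x j) k)).
Proof.
elim: phi x => {n} [n t u|n r t|n m c cc psi IH|n psi IH|n psi IH] x /=.
- by apply: ulim_dist_ueq; exact: teval_ultrapower.
- apply: ulim_near_eq => e e0; have e20 : 0 < e / 2 by exact: divr_gt0.
  have : \forall k \near U, forall j, (dist (useq (teval x (t j)) k)
      (teval (fun i => useq (x i) k) (t j)) < (rel_mod r (e / 2))%:E)%E.
    by apply: near_forall_fin => j; apply: teval_ultrapower; exact: rel_mod_gt0.
  apply: filterS => k h; apply: (@le_lt_trans _ _ (e / 2)).
    by apply: rel_interp_uc => //; apply/max_dist_ltP => //; exact: rel_mod_gt0.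
  by rewrite gtr_pMr// invf_lt1// ltr1n.
- apply/esym/ulim_eqP.
  apply: (@cvg_comp _ _ _ (fun k => (fun j => eval (psi j) (fun i => useq (x i) k)))
    c U (nbhs ((fun j => eval (psi j) x) : {ptws 'I_m -> \bar R}))); last exact: cc.
  by apply/ptws_cvgP => j; rewrite IH; exact: ulim_cvg.
- apply/eqP; rewrite eq_le; apply/andP; split.
    apply: ge_ereal_sup => _ [y _ <-]; rewrite IH; apply: ulim_le; apply: nearW => k.
    by rewrite useq_tcons; apply: ereal_sup_ubound; exists (useq y k).
  rewrite leNgt; apply/negP.
  set l := ereal_sup _; set l' := ulim _ _ => /ereal_between[r /andP[lr rl']].
  have [x0] := carrier_inhabited N.
  have /choice[y yP] : forall k, exists y : N,
      (r < ereal_sup [set eval psi (tcons y (fun j => useq (x j) k)) | y in [set: N]])%E ->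
      (r < eval psi (tcons y (fun j => useq (x j) k)))%E.
    move=> k; set s := ereal_sup _.
    have [/ereal_sup_gt[_ [y _ <-] ry]|sr] := ltP r s; first by exists y.
    by exists x0.
  have : (r <= l)%E; last by rewrite leNgt lr.
  apply: (@le_trans _ _ (eval psi (tcons (uclass y) x))).
    rewrite IH -(ulim_cst U r) ulim_tcons.
    by apply: ulim_le; apply: filterS (ulim_gt rl') => k /yP /ltW.
  by apply: ereal_sup_ubound; exists (uclass y).
- apply/eqP; rewrite eq_le; apply/andP; split; last first.
    apply: le_ereal_inf_tmp => _ [y _ <-]; rewrite IH; apply: ulim_le; apply: nearW => k.
    by rewrite useq_tcons; apply: ereal_inf_lbound; exists (useq y k).
  rewrite leNgt; apply/negP.
  set l := ereal_inf _; set l' := ulim _ _ => /ereal_between[r /andP[l'r rl]].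
  have [x0] := carrier_inhabited N.
  have /choice[y yP] : forall k, exists y : N,
      (ereal_inf [set eval psi (tcons y (fun j => useq (x j) k)) | y in [set: N]] < r)%E ->
      (eval psi (tcons y (fun j => useq (x j) k)) < r)%E.
    move=> k; set s := ereal_inf _.
    have [/ereal_inf_lt[_ [y _ <-] ry]|rs] := ltP s r; first by exists y.
    by exists x0.
  have : (l <= r)%E; last by rewrite leNgt rl.
  apply: (@le_trans _ _ (eval psi (tcons (uclass y) x))).
    by apply: ereal_inf_lbound; exists (uclass y).
  rewrite IH -(ulim_cst U r) ulim_tcons.
  by apply: ulim_le; apply: filterS (ulim_lt l'r) => k /yP /ltW.
Qed.

Lemma Los n (phi : formula L n) (a : nat -> 'I_n -> N) :
  (fun k => eval phi (a k)) @ U --> eval phi (fun i => uclass (a ^~ i)).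
Proof.
rewrite Los_useq; apply/ulim_eqP; apply: ulim_near_eq => e /(cval_uc phi)[d d0 dP].
have : \forall k \near U, forall i,
    (dist (a k i) (useq (uclass (a ^~ i)) k) < d%:E)%E.
  by apply: near_forall_fin => i; apply: ueq_sym => //; exact: uclass_ueq.
by apply: filterS => k; exact: dP.
Qed.

Lemma Los_tp n (a : nat -> 'I_n -> N) :
  (fun k => tp (a k)) @ U --> tp (fun i => uclass (a ^~ i)).
Proof. by apply/ptws_cvgP => phi; exact: Los. Qed.

Lemma uclass_dist_small (a b : nat -> N) :
  (forall e : R, 0 < e -> \forall k \near U, (dist (a k) (b k) < e%:E)%E) ->
  uclass a = uclass b.
Proof. by move=> ab; apply/ucl_eqP. Qed.

(** A constant family gives the diagonal embedding; a sequence of automorphisms gives the copy of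
    [M] in [M^U] along which its translates converge. *)
Lemma ultrapower_elementary (h : nat -> N -> N) : (forall k, elementary (h k)) ->
  elementary (fun x => uclass (h ^~ x)).
Proof.
move=> eh n phi a; have h1 := @Los _ phi (fun k => h k \o a).
apply: ultra_cvg_unique h1 _; have -> : (fun k => eval phi (h k \o a)) = fun=> eval phi a.
  by apply/funext => k; exact: eh.
exact: cvg_cst.
Qed.

Lemma ultrapower_model (T : theory L) : model T N -> model T ultrapower.
Proof.
move=> mN; have /elementary_Th : elementary (fun x => uclass (fun=> x)).
  by apply: (@ultrapower_elementary (fun=> id)) => k n phi a.
by move=> <-.
Qed.

End Ultrapower.

(** * Elementary substructures *)

Section Connectives.
Variables (R : realType) (L : language R).

Definition clamp (r : R) : R := Num.max (-1) (Num.min 1 r).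

Lemma contract_expand (r : R) : contract (expand r) = clamp r.
Proof.
rewrite /clamp; have [r1|r1] := leP 1 r.
  by rewrite expand1//= max_r//; lra.
have [r2|r2] := leP r (-1); first by rewrite expandN1.
by rewrite expandK// inE ler_norml; apply/andP; split; lra.
Qed.

Lemma clampP (r : R) : [\/ r <= -1 /\ clamp r = -1,
  (-1 <= r /\ r <= 1) /\ clamp r = r | 1 <= r /\ clamp r = 1].
Proof.
rewrite /clamp; have [r1|r1] := leP 1 r.
  by constructor 3; split => //; rewrite max_r//; lra.
have [r2|r2] := leP r (-1); first by constructor 1.
by constructor 2; split => //; split; lra.
Qed.

Lemma clamp_lip (r s : R) : `|clamp r - clamp s| <= `|r - s|.
Proof.
wlog rs : r s / r <= s.
  by move=> H; have [/H//|/ltW/H] := leP r s; rewrite distrC (distrC s).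
rewrite [leRHS]ler0_norm; last lra.
by rewrite ler_norml; apply/andP; split; have [[? ->]|[[? ?] ->]|[? ->]] := clampP r;
  have [[? ->]|[[? ?] ->]|[? ->]] := clampP s; lra.
Qed.

(** Connectives made from real functions are truncated to [-1, 1]; strict comparison with a
    threshold in this range does not see the truncation. *)
Lemma clamp_lt (r s : R) : -1 < s -> s <= 1 -> (clamp r < s) = (r < s).
Proof.
move=> s0 s1; have [[? ->]|[[? ?] ->]|[? ->]] := clampP r => //.
  by apply/idP/idP => ?; lra.
by apply/idP/idP => ?; lra.
Qed.

(* Every 1-Lipschitz function of two contracted values is a connective, up to
   truncation to [-1, 1]. *)
Definition conn2 (h : R -> R -> R) (v : {ptws 'I_2 -> \bar R}) : \bar R :=
  expand (h (contract (v ord0)) (contract (v (lift ord0 ord0)))).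

Definition nonexpansive (h : R -> R -> R) :=
  forall x y x' y', `|h x y - h x' y'| <= `|x - x'| + `|y - y'|.

Lemma conn2_continuous h : nonexpansive h -> continuous (conn2 h).
Proof.
move=> hh v; apply: (@cvg_contractP R _ (nbhs v) _ (conn2 h) (conn2 h v)).2 => e e0.
have e20 : 0 < e / 2 by exact: divr_gt0.
have vv i : (fun w : {ptws 'I_2 -> \bar R} => w i) @ nbhs v --> v i.
  by apply: ((@ptws_cvgP _ _ _ (nbhs v) _ (fun w => w) v).1 _ i); exact: cvg_id.
have /cvg_contractP /(_ _ e20) v0 := vv ord0.
have /cvg_contractP /(_ _ e20) v1 := vv (lift ord0 ord0).
apply: filterS2 v0 v1 => w w0 w1; rewrite /conn2 !contract_expand.
apply: le_lt_trans (clamp_lip _ _) _; apply: le_lt_trans (hh _ _ _ _) _.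
by rewrite (splitr e) ltrD.
Qed.

Definition fconn2 (h : R -> R -> R) (hh : nonexpansive h) n (phi psi : formula L n) :=
  FConn (conn2_continuous hh) (fun i : 'I_2 => if i == ord0 then phi else psi).

Lemma cval_conn2 (N : mstructure L) h (hh : nonexpansive h) n (phi psi : formula L n)
    (a : 'I_n -> N) : cval (fconn2 hh phi psi) a = clamp (h (cval phi a) (cval psi a)).
Proof. by rewrite /cval/= /conn2 contract_expand. Qed.

Lemma nonexpansive_sub : nonexpansive (fun x y => x - y).
Proof.
move=> x y x' y'; have -> : x - y - (x' - y') = (x - x') - (y - y') by ring.
exact: ler_normB.
Qed.

Lemma nonexpansive_max : nonexpansive Num.max.
Proof.
move=> x y x' y'; have := ler_norm (x - x'); have := ler_norm (y - y').
have := ler_norm (x' - x); have := ler_norm (y' - y); rewrite (distrC x') (distrC y').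
have := normr_ge0 (x - x'); have := normr_ge0 (y - y').
by rewrite ler_norml => ? ? ? ? ? ?; apply/andP; split;
  case: (leP x y) => ?; case: (leP x' y') => ?; lra.
Qed.

Lemma nonexpansive_shift (r : R) : nonexpansive (fun x _ => x - r).
Proof. by move=> x y x' y'; rewrite opprB addrA subrK lerDl. Qed.

Lemma nonexpansive_opp : nonexpansive (fun x _ => - x).
Proof. by move=> x y x' y'; rewrite -opprD normrN lerDl. Qed.

End Connectives.

Section Substructures.
Variables (R : realType) (L : language R) (N : mstructure L) (D : Type) (c : D -> N).

(** Metric form of the test: near-minimal points suffice, and only infima are mentioned. The points
    [c j] need only be dense in the submodel, so [D] may be countable. *)
Definition TarskiVaught := forall n (phi : formula L n.+1) (s : 'I_n -> D) (e : R),
  0 < e -> exists j, forall y,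
    cval phi (tcons (c j) (c \o s)) <= cval phi (tcons y (c \o s)) + e.

Lemma TarskiVaught_dense (u : forall n, nat -> formula L n) :
  (forall n (phi : formula L n) (e : R), 0 < e -> exists k, forall (a : 'I_n -> N),
     `|cval phi a - cval (u n k) a| < e) ->
  (forall n k m (s : 'I_n -> D), exists j, forall y,
    cval (u n.+1 k) (tcons (c j) (c \o s)) <=
    cval (u n.+1 k) (tcons y (c \o s)) + m.+1%:R^-1) ->
  TarskiVaught.
Proof.
move=> ud uTV n phi s e e0; have e30 : 0 < e / 3 by exact: divr_gt0.
have [k kP] := ud _ phi _ e30.
have [m me] := filter_ex (inv_nat_lt e30).
have [j jP] := uTV n k m s; exists j => y.
have := jP y; have := kP (tcons (c j) (c \o s)); have := kP (tcons y (c \o s)).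
rewrite !ltr_norml => /andP[? ?] /andP[? ?]; set q := m.+1%:R^-1 in me *; lra.
Qed.

Hypothesis TV : TarskiVaught.

Definition dense_closure : set N :=
  [set x | forall e : R, 0 < e -> exists j, (dist (c j) x < e%:E)%E].

Lemma dense_closureT j : dense_closure (c j).
Proof. by move=> e e0; exists j; rewrite distxx lte_fin. Qed.

Lemma dense_closure_tuple n (a : 'I_n -> N) : (forall i, dense_closure (a i)) ->
  forall e : R, 0 < e -> exists s : 'I_n -> D, forall i, (dist (c (s i)) (a i) < e%:E)%E.
Proof.
move=> aS e e0; have /choice[s sP] : forall i, exists j, (dist (c j) (a i) < e%:E)%E.
  by move=> i; exact: aS.
by exists s.
Qed.

Lemma TV_closure n (phi : formula L n.+1) (a : 'I_n -> N) y (e : R) :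
  (forall i, dense_closure (a i)) -> 0 < e ->
  exists j, cval phi (tcons (c j) a) <= cval phi (tcons y a) + e.
Proof.
move=> aS e0; have e30 : 0 < e / 3 by exact: divr_gt0.
have [d d0 dP] := cval_uc phi e30.
have [s sP] := dense_closure_tuple aS d0.
have [j jP] := TV phi s e30; exists j.
have := dP _ _ _ (dist_tcons (c j) d0 sP); have := dP _ _ _ (dist_tcons y d0 sP).
have := jP y; rewrite !ltr_norml => ? /andP[? ?] /andP[? ?]; lra.
Qed.

(** The distance from [x_0] to the image, as a formula, reaches its minimum 0 at the image itself,
    so the test yields points [c j] arbitrarily close to it. *)
Lemma dense_closure_fun f (x : 'I_(fun_ar f) -> N) :
  (forall i, dense_closure (x i)) -> dense_closure (fun_interp N f x).
Proof.
move=> xS e e0.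
pose t : term L (fun_ar f).+1 := TApp (fun i => TVar L (lift ord0 i)).
pose phi := FDist (TVar L ord0) t.
have phiE y : cval phi (tcons y x) = contract (dist y (fun_interp N f x)).
  rewrite /cval/=; congr contract; congr dist; first by rewrite /tcons unlift_none.
  by congr fun_interp; apply/funext => i; rewrite /tcons liftK.
have ce : 0 < contract e%:E by rewrite -(contract0 R) lt_contract lte_fin.
have [|j] := TV_closure phi (fun_interp N f x) xS (e := contract e%:E / 2).
  exact: divr_gt0.
rewrite !phiE distxx contract0 add0r => je; exists j.
by rewrite -lt_contract; lra.
Qed.

Definition sub_carrier := {x : N | dense_closure x}.

Let sdist (x y : sub_carrier) := dist (sval x) (sval y).

Lemma sub_gen_metric : gen_metric sdist.
Proof.
have [d0 d00 dC dt] := dist_gen_metric N; split=> [x y|x y|x y|x y z].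
- exact: d0.
- split=> [/d00 xy|->]; last exact/d00.
  by case: x y xy => x xP [y yP] /= xy; exact: eq_exist.
- exact: dC.
- exact: dt.
Qed.

Lemma sub_complete : complete_metric sdist.
Proof.
move=> x xC; have [l lP] := dist_complete (u := fun k => sval (x k)) xC.
suff lS : dense_closure l by exists (exist _ l lS).
move=> e e0; have e20 : 0 < e / 2 by exact: divr_gt0.
have [m /(_ _ (leqnn _)) ml] := lP _ e20.
have [j jm] := svalP (x m) _ e20; exists j; exact: dist_lt_split jm ml.
Qed.

Definition sub_fun f (x : 'I_(fun_ar f) -> sub_carrier) : sub_carrier :=
  exist _ (fun_interp N f (fun i => sval (x i))) (dense_closure_fun (fun i => svalP (x i))).

Lemma sub_inhabited : inhabited sub_carrier.
Proof.
have [x0] := carrier_inhabited N.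
have [j _] := TV (FDist (TVar L ord0) (TVar L ord0))
  (fun i : 'I_0 => False_rect D (notF (ltn_ord i))) ltr01.
by constructor; exact: exist _ (c j) (dense_closureT j).
Qed.

Definition substructure : mstructure L :=
  @MStructure R L sub_carrier sub_inhabited sdist sub_gen_metric sub_complete sub_fun
    (fun r x => rel_interp N r (fun i => sval (x i)))
    (fun f e x y => @fun_interp_uc _ _ N f e _ _)
    (fun r e x y => @rel_interp_uc _ _ N r e _ _).

Definition sub_incl (x : substructure) : N := sval x.

Lemma sub_incl_closure x : dense_closure (sub_incl x).
Proof. exact: svalP. Qed.

Lemma teval_sub n (t : term L n) (a : 'I_n -> substructure) :
  teval (sub_incl \o a) t = sub_incl (teval a t).
Proof. by elim: t => //= f s IH; congr fun_interp; apply/funext => j. Qed.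

Lemma sub_incl_elementary : elementary sub_incl.
Proof.
move=> n; elim=> {n} [n t u|n r t|n k d cd psi IH|n psi IH|n psi IH] a /=.
- by rewrite !teval_sub.
- by congr rel_interp; apply/funext => j; rewrite teval_sub.
- by congr d; apply/funext => j; exact: IH.
- apply/eqP; rewrite eq_le; apply/andP; split; last first.
    by apply: ereal_sup_le => _ [x _ <-]; exists (sub_incl x) => //; rewrite -IH tcons_comp.
  apply: ge_ereal_sup => _ [y _ <-]; rewrite -le_contract.
  apply/ler_addgt0Pr => e e0.
  (* The test concerns infima only; a supremum is handled through the opposite formula, on which
     truncation is harmless since contracted values lie in [-1, 1]. *)
  have [] := TV_closure (fconn2 (@nonexpansive_opp R) psi psi) y (fun i => svalP (a i)) e0.
  move=> j; rewrite !cval_conn2.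
  have cK x : clamp (- contract x) = - contract x.
    rewrite /clamp; have := contract_le1 x; rewrite ler_norml => /andP[? ?].
    by rewrite min_r ?max_r//; lra.
  rewrite !cK => h.
  have h' : contract (eval psi (tcons (c j) (sub_incl \o a))) <=
     contract (ereal_sup [set eval psi (tcons x a) | x in [set: substructure]]).
    apply: contract_sup_ge; exists (exist _ (c j) (dense_closureT j)) => //.
    by rewrite -IH tcons_comp.
  move: h h'; rewrite /cval /sub_incl /comp /=; lra.
- apply/eqP; rewrite eq_le; apply/andP; split.
    by apply: ereal_inf_le_tmp => _ [x _ <-]; exists (sub_incl x) => //;
      rewrite -IH tcons_comp.
  apply: le_ereal_inf_tmp => _ [y _ <-]; rewrite -le_contract.
  apply/ler_addgt0Pr => e e0.
  have [j h] := TV_closure psi y (fun i => svalP (a i)) e0.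
  apply: le_trans h; apply: contract_inf_le.
  exists (exist _ (c j) (dense_closureT j)) => //.
  by rewrite -IH tcons_comp.
Qed.

End Substructures.
Arguments sub_incl_elementary {R L N D c} TV.

(** * Separable elementary submodels *)

Section LowenheimSkolem.
Variables (R : realType) (L : language R).
Hypothesis hL : separable_language L.

Definition dense_formula n : nat -> formula L n := projT1 (cid (hL n)).

Lemma dense_formulaP n (phi : formula L n) (e : R) : 0 < e ->
  exists k, forall (N : mstructure L) (a : 'I_n -> N),
    `|cval phi a - cval (dense_formula n k) a| < e.
Proof. exact: (projT2 (cid (hL n)) phi e). Qed.

Lemma dense_TarskiVaught (N : mstructure L) (D : Type) (c : D -> N) :
  (forall n k m (s : 'I_n -> D), exists j, forall y,
    cval (dense_formula n.+1 k) (tcons (c j) (c \o s)) <=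
    cval (dense_formula n.+1 k) (tcons y (c \o s)) + m.+1%:R^-1) ->
  TarskiVaught c.
Proof.
apply: TarskiVaught_dense => n phi e e0.
by have [k kP] := dense_formulaP phi e0; exists k => a; exact: kP.
Qed.

Lemma substructure_separable (N : mstructure L) (D : countType) (c : D -> N)
    (TV : TarskiVaught c) : separable_structure (substructure TV).
Proof.
have [j0 _] := TV _ (FDist (TVar L ord0) (TVar L ord0))
  (fun i : 'I_0 => False_rect D (notF (ltn_ord i))) 1 ltr01.
pose s j : substructure TV := exist _ (c j) (dense_closureT c j).
exists (fun k => if unpickle k is Some j then s j else s j0) => x e e0.
by have [j jx] := sub_incl_closure x e0; exists (pickle j); rewrite pickleK.
Qed.

Lemma near_inf (N : mstructure L) n (phi : formula L n.+1) (a : 'I_n -> N) (e : R) :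
  0 < e -> exists x, forall y, cval phi (tcons x a) <= cval phi (tcons y a) + e.
Proof.
move=> e0; have : cval (FInf phi) a < cval (FInf phi) a + e by rewrite ltrDl.
move=> /cval_inf_lt[x xe]; exists x => y; apply: le_trans (ltW xe) _.
by rewrite lerD2r; exact: eval_tcons_inf.
Qed.

(** Used to bring finite tuples of ultrapowers into separable models, where categoricity applies. *)
Lemma Lowenheim_Skolem (N : mstructure L) m (a : 'I_m -> N) :
  exists (N0 : mstructure L) (f : N0 -> N), [/\ elementary f,
    separable_structure N0 & exists b, f \o b = a].
Proof.
have [x0] := carrier_inhabited N.
have /choice[w wP] : forall z : (nat * nat * nat) * seq N, exists x, forall y,
    cval (dense_formula z.1.1.1.+1 z.1.1.2) (tcons x (fun i => nth x0 z.2 i)) <=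
    cval (dense_formula z.1.1.1.+1 z.1.1.2) (tcons y (fun i => nth x0 z.2 i)) +
      z.1.2.+1%:R^-1.
  by move=> z; apply: near_inf.
(* Indexing the witnesses by trees, the countably many Skolem terms, closes the
   construction under witnesses at once. *)
pose c := fix c (t : GenTree.tree nat) : N :=
  match t with
  | GenTree.Leaf i => if insub i is Some j then a j else x0
  | GenTree.Node p ts =>
    if unpickle p is Some z then w (z, map c ts) else x0
  end.
have TV : TarskiVaught c.
  apply: dense_TarskiVaught => n k l s.
  exists (GenTree.Node (pickle (n, k, l)) [seq s i | i <- enum 'I_n]).
  move=> y; rewrite [c (GenTree.Node _ _)]/= pickleK.
  have := wP ((n, k, l), map c [seq s i | i <- enum 'I_n]) y.
  rewrite /=; have -> // :
      (fun i : 'I_n => nth x0 (map c [seq s i0 | i0 <- enum 'I_n]) i) = c \o s.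
  by apply/funext => i; rewrite -map_comp (nth_map i) ?size_enum_ord// nth_ord_enum.
exists (substructure TV), (@sub_incl _ _ _ _ _ TV); split.
- exact: sub_incl_elementary.
- exact: substructure_separable.
- exists (fun i => exist _ (c (GenTree.Leaf (val i))) (dense_closureT c _)).
  by apply/funext => i; rewrite /sub_incl/= valK.
Qed.

End LowenheimSkolem.

(** * Omitting types and homogeneity *)

(* Formulas are evaluated here at sequences [nat -> N], so that variables have
   names independent of the number of free variables. *)
Section NamedVariables.
Variables (R : realType) (L : language R) (N : mstructure L).
Implicit Types (F G : (nat -> N) -> R) (a b : nat -> N).

Definition restr (X : Type) k (a : nat -> X) : 'I_k -> X := fun i => a i.

Definition ldef k F := exists phi : formula L k, forall a, F a = cval phi (restr a).

Lemma ldef_cval n (phi : formula L n) (s : 'I_n -> nat) :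
  exists k, ldef k (fun a => cval phi (fun i => a (s i))).
Proof.
pose k := (\max_i s i).+1.
have sk i : (s i < k)%N by rewrite ltnS; exact: leq_bigmax.
exists k, (formula_rename phi (fun i => Ordinal (sk i))) => a.
by rewrite /cval eval_rename.
Qed.

Lemma ldef_widen k l F : (k <= l)%N -> ldef k F -> ldef l F.
Proof.
move=> kl [phi phiP]; exists (formula_rename phi (widen_ord kl)) => a.
by rewrite phiP /cval eval_rename.
Qed.

Lemma ldef_conn2 h k F G : @nonexpansive R h -> ldef k F -> ldef k G ->
  ldef k (fun a => clamp (h (F a) (G a))).
Proof.
move=> hh [phi phiP] [psi psiP]; exists (fconn2 hh phi psi) => a.
by rewrite cval_conn2 phiP psiP.
Qed.

Lemma ldef_comp k F (s : nat -> nat) : ldef k F -> exists l, ldef l (fun a => F (a \o s)).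
Proof.
move=> [phi phiP]; have [l lP] := ldef_cval phi (fun i => s i); exists l.
by have [psi psiP] := lP; exists psi => a; rewrite phiP -psiP.
Qed.

Definition upd (X : Type) (a : nat -> X) j x : nat -> X :=
  fun i => if i == j then x else a i.

Lemma ldef_inf k F : ldef k.+1 F -> exists2 G, ldef k G &
  forall a r, G a < r <-> exists x, F (upd a k x) < r.
Proof.
move=> [phi phiP].
(* [FInf] binds variable 0, whereas [upd a k] changes the last of the [k.+1] variables: [s] moves
   that one to the front. *)
pose s (i : 'I_k.+1) : 'I_k.+1 := if unlift ord_max i is Some j then lift ord0 j else ord0.
exists (fun a => cval (FInf (formula_rename phi s)) (restr a)).
  by exists (FInf (formula_rename phi s)).
move=> a r; rewrite cval_inf_lt.
have E x : cval (formula_rename phi s) (tcons x (restr a)) = F (upd a k x).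
  rewrite phiP /cval eval_rename; congr (contract (eval _ _)); apply/funext => i.
  rewrite /s /tcons /restr /upd /=; case: (unliftP ord_max i) => [j ->|->].
    by rewrite liftK /= /bump leqNgt ltn_ord add0n ltn_eqF.
  by rewrite unlift_none eqxx.
by split=> -[x]; rewrite ?E => h; exists x; rewrite ?E.
Qed.

Definition mix (X : Type) k (a b : nat -> X) : nat -> X :=
  fun i => if (i < k)%N then a i else b i.

Lemma ldef_infs l k F : ldef l F -> exists2 G, ldef k G &
  forall a r, G a < r <-> exists z, F (mix k a z) < r.
Proof.
(* Padding [l] to [k + l] lets the induction remove variables from the top until [k] remain. *)
move=> lF; have {lF} : ldef (k + l) F by apply: ldef_widen lF; exact: leq_addl.
elim: l F => [|l IH] F lF.
  rewrite addn0 in lF; exists F => // a r.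
  have [phi phiP] := lF; have E z : F (mix k a z) = F a.
    by rewrite !phiP; congr cval; apply/funext => i; rewrite /restr /mix ltn_ord.
  by split=> [h|[z]]; [exists a; rewrite E|rewrite E].
rewrite addnS in lF; have [F1 lF1 F1P] := ldef_inf lF.
have [G lG GP] := IH _ lF1; exists G => // a r; rewrite GP; split=> [[z /F1P[x h]]|[z h]].
  exists (upd z (k + l) x); move: h; congr (F _ < r); apply/funext => i.
  rewrite /mix /upd; case: eqP => [->|//].
  by rewrite ltnNge leq_addr.
exists z; apply/F1P; exists (z (k + l)%N); move: h; congr (F _ < r).
apply/funext => i; rewrite /mix /upd; case: eqP => [->|//].
by rewrite ltnNge leq_addr.
Qed.

Lemma ldef_shift k F (r : R) : ldef k F -> ldef k (fun a => clamp (F a - r)).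
Proof.
move=> lF; apply: (@ldef_conn2 (fun x _ => x - r) k F F) => //.
exact: nonexpansive_shift.
Qed.

Lemma ldef_opp k F (r : R) : ldef k F -> ldef k (fun a => clamp (r - F a)).
Proof.
move=> lF; apply: (@ldef_conn2 (fun x _ => r - x) k F F) => // x y x' y'.
have -> : r - x - (r - x') = - (x - x') by ring.
by rewrite normrN lerDl.
Qed.

Lemma clamp_id (x : R) : -1 <= x <= 1 -> clamp x = x.
Proof. by move=> /andP[? ?]; rewrite /clamp min_r// max_r. Qed.

Lemma ldef_bounded k F a : ldef k F -> -1 <= F a <= 1.
Proof. by move=> [phi ->]; rewrite -ler_norml contract_le1. Qed.

Lemma ldef_max k F G : ldef k F -> ldef k G -> ldef k (fun a => Num.max (F a) (G a)).
Proof.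
move=> lF lG; have [psi psiP] := ldef_conn2 (@nonexpansive_max R) lF lG.
exists psi => a; rewrite -psiP clamp_id//.
have := ldef_bounded a lF; have := ldef_bounded a lG.
by move=> ? ?; case: (leP (F a) (G a)).
Qed.

(** With the threshold fixed at 0, intersections become maxima and projections become infima. *)
Definition lopen k (Q : set (nat -> N)) :=
  exists2 F, ldef k F & forall a, Q a <-> F a < 0.

(* [Q'] is contained in [Q] with a margin: the complement of [Q] is covered by an
   open set disjoint from [Q']; see [lsep_compl]. *)
Definition lsep k (Q' Q : set (nat -> N)) :=
  exists2 F, ldef k F &
    exists2 s : R, 0 < s <= 1 & forall a, (Q' a -> F a < 0) /\ (F a < s -> Q a).

Lemma lopen_widen k l Q : (k <= l)%N -> lopen k Q -> lopen l Q.
Proof. by move=> kl [F lF FP]; exists F => //; exact: ldef_widen lF. Qed.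

Lemma lsep_widen k l Q' Q : (k <= l)%N -> lsep k Q' Q -> lsep l Q' Q.
Proof. by move=> kl [F lF FP]; exists F => //; exact: ldef_widen lF. Qed.

Lemma lopen_lt k F (r : R) : ldef k F -> lopen k [set a : nat -> N | F a < r].
Proof.
move=> lF; exists (fun a => clamp (F a - r)); first exact: ldef_shift.
by move=> a /=; rewrite clamp_lt// ?subr_lt0//; lra.
Qed.

Lemma lopen_gt k F (r : R) : ldef k F -> lopen k [set a : nat -> N | r < F a].
Proof.
move=> lF; exists (fun a => clamp (r - F a)); first exact: ldef_opp.
by move=> a /=; rewrite clamp_lt// ?subr_lt0//; lra.
Qed.

Lemma lsep_lt k F (r s : R) : r < s -> ldef k F ->
  lsep k [set a : nat -> N | F a < r] [set a : nat -> N | F a < s].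
Proof.
move=> rs lF; exists (fun a => clamp (F a - r)); first exact: ldef_shift.
exists (Num.min 1 (s - r)); first by rewrite lt_min ge_min lexx ltr01/= andbT; lra.
move=> a /=; split; first by (rewrite clamp_lt; [move=> ?; lra|lra|lra]).
by have [h|h] := leP 1 (s - r); (rewrite clamp_lt; [move=> ?; lra|lra|lra]).
Qed.

Lemma lopenI k Q1 Q2 : lopen k Q1 -> lopen k Q2 -> lopen k (Q1 `&` Q2).
Proof.
move=> [F lF FP] [G lG GP]; exists (fun a => Num.max (F a) (G a)); first exact: ldef_max.
by move=> a; rewrite gt_max; split=> [[/FP -> /GP ->]//|/andP[/FP ? /GP ?]].
Qed.

Lemma lsepI k Q1 Q2 Q1' Q2' : lsep k Q1' Q1 -> lsep k Q2' Q2 ->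
  lsep k (Q1' `&` Q2') (Q1 `&` Q2).
Proof.
move=> [F lF [s s01 FP]] [G lG [t t01 GP]]; exists (fun a => Num.max (F a) (G a)).
  exact: ldef_max.
exists (Num.min s t); first by rewrite lt_min ge_min; lra.
move=> a; rewrite gt_max; split=> [[/(FP a).1 -> /(GP a).1 ->]//|].
rewrite gt_max !lt_min => /andP[/andP[Fs _] /andP[_ Gt]].
by split; [apply/(FP a).2|apply/(GP a).2].
Qed.

Lemma lopen_comp k Q (s : nat -> nat) : lopen k Q ->
  exists l, lopen l [set a : nat -> N | Q (a \o s)].
Proof.
move=> [F lF FP]; have [l lP] := ldef_comp s lF; exists l.
by exists (fun a => F (a \o s)) => // a; exact: FP.
Qed.

Lemma lsep_comp k Q' Q (s : nat -> nat) : lsep k Q' Q ->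
  exists l, lsep l [set a : nat -> N | Q' (a \o s)] [set a : nat -> N | Q (a \o s)].
Proof.
move=> [F lF [r r01 FP]]; have [l lP] := ldef_comp s lF; exists l.
by exists (fun a => F (a \o s)) => //; exists r => // a; exact: FP.
Qed.

Lemma lopen_proj l k Q : lopen l Q -> lopen k [set a : nat -> N | exists z, Q (mix k a z)].
Proof.
move=> [F lF FP]; have [G lG GP] := ldef_infs k lF; exists G => // a.
by rewrite GP; split=> -[z /FP ?]; exists z.
Qed.

Lemma lsep_proj l k Q' Q : lsep l Q' Q ->
  lsep k [set a : nat -> N | exists z, Q' (mix k a z)]
         [set a : nat -> N | exists z, Q (mix k a z)].
Proof.
move=> [F lF [r r01 FP]]; have [G lG GP] := ldef_infs k lF; exists G => //.
exists r => // a; split => [[z /(FP _).1 h]|/GP[z /(FP _).2 h]]; last by exists z.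
by apply/GP; exists z.
Qed.

(** The condition [0 < F] is open and misses [Q'], while its failure gives [F a <= 0 < r], hence
    [Q a]: the margin replaces the open complement that an open set lacks. *)
Lemma lsep_compl k Q' Q : lsep k Q' Q ->
  exists2 Qc, lopen k Qc & forall a, (Q' a -> ~ Qc a) /\ (~ Qc a -> Q a).
Proof.
move=> [F lF [r /andP[r0 r1] FP]]; exists [set a : nat -> N | 0 < F a].
  exact: lopen_gt.
move=> a; split=> /=; first by move=> /(FP a).1 Fa0 Fa0'; lra.
by move/negP; rewrite -leNgt => Fa; apply/(FP a).2; lra.
Qed.

Lemma lopen_regular k Q a : lopen k Q -> Q a ->
  exists Q', [/\ lopen k Q', Q' a & lsep k Q' Q].
Proof.
move=> [F lF FP] /FP Fa; exists [set b : nat -> N | F b < F a / 2]; split.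
- exact: lopen_lt.
- by rewrite /=; lra.
- have -> : Q = [set b : nat -> N | F b < 0] by apply/seteqP; split => b /FP.
  by apply: lsep_lt => //; lra.
Qed.

Lemma lopenT k : lopen k setT.
Proof.
(* For [k = 0] no free variable is available for an atomic formula, so one is bound. Contracted
   values are at most 1, so subtracting 2 makes the result negative. *)
pose zero := FInf (FDist (TVar L (ord0 : 'I_k.+1)) (TVar L ord0)).
exists (fun a => cval (fconn2 (@nonexpansive_shift R 2) zero zero) (restr a)).
  by eexists.
move=> a; split => // _; rewrite cval_conn2 clamp_lt//.
have := contract_le1 (eval zero (restr a)).
by rewrite -/(cval _ _) ler_norml => /andP[? ?]; lra.
Qed.

Definition close k (e : R) a b := forall i, (i < k)%N -> (dist (a i) (b i) < e%:E)%E.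

Lemma ldef_dist i j : exists k, ldef k (fun a => contract (dist (a i) (a j))).
Proof.
exact: (ldef_cval (FDist (TVar L (ord0 : 'I_2)) (TVar L (lift ord0 ord0)))
  (fun t => if t == ord0 then i else j)).
Qed.

Lemma lopen_dist i j (e : R) : exists k,
  lopen k [set a : nat -> N | (dist (a i) (a j) < e%:E)%E].
Proof.
have [k kP] := ldef_dist i j; exists k.
have -> : [set a : nat -> N | (dist (a i) (a j) < e%:E)%E] =
    [set a : nat -> N | contract (dist (a i) (a j)) < contract e%:E].
  by apply/seteqP; split=> a; rewrite /mkset lt_contract.
exact: lopen_lt.
Qed.

Lemma lsep_dist i j (e e' : R) : e < e' -> exists k,
  lsep k [set a : nat -> N | (dist (a i) (a j) < e%:E)%E]
         [set a : nat -> N | (dist (a i) (a j) < e'%:E)%E].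
Proof.
move=> ee; have [k kP] := ldef_dist i j; exists k.
have E r : [set a : nat -> N | (dist (a i) (a j) < r%:E)%E] =
    [set a : nat -> N | contract (dist (a i) (a j)) < contract r%:E].
  by apply/seteqP; split=> a; rewrite /mkset lt_contract.
by rewrite !E; apply: lsep_lt => //; rewrite lt_contract lte_fin.
Qed.

Lemma lopen_close m (s t : nat -> nat) (e : R) :
  exists k, lopen k [set a : nat -> N | close m e (a \o s) (a \o t)].
Proof.
elim: m => [|m [k IH]].
  exists 0%N; have -> : [set a : nat -> N | close 0 e (a \o s) (a \o t)] = setT.
    by apply/seteqP.
  exact: lopenT.
have [l lP] := lopen_dist (s m) (t m) e; exists (maxn k l).
have -> : [set a : nat -> N | close m.+1 e (a \o s) (a \o t)] =
    [set a : nat -> N | close m e (a \o s) (a \o t)] `&`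
    [set a : nat -> N | (dist (a (s m)) (a (t m)) < e%:E)%E].
  apply/seteqP; split=> a /= h; first by split=> [i im|]; apply: h => //; exact: ltnW.
  by move=> i; rewrite ltnS leq_eqVlt => /predU1P[->|im]; [exact: h.2|exact: h.1].
by apply: lopenI; [apply: lopen_widen IH|apply: lopen_widen lP];
  rewrite ?leq_maxl ?leq_maxr.
Qed.

Lemma lsep_close m (s t : nat -> nat) (e e' : R) : e < e' -> exists k,
  lsep k [set a : nat -> N | close m e (a \o s) (a \o t)]
         [set a : nat -> N | close m e' (a \o s) (a \o t)].
Proof.
move=> ee; elim: m => [|m [k IH]].
  exists 0%N.
  have E r : [set a : nat -> N | close 0 r (a \o s) (a \o t)] = setT by apply/seteqP.
  rewrite !E; have [F lF FP] := lopenT 0; exists F => //; exists 1; first lra.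
  by move=> a; split => // _; exact/FP.
have [l lP] := lsep_dist (s m) (t m) ee; exists (maxn k l).
have E r : [set a : nat -> N | close m.+1 r (a \o s) (a \o t)] =
    [set a : nat -> N | close m r (a \o s) (a \o t)] `&`
    [set a : nat -> N | (dist (a (s m)) (a (t m)) < r%:E)%E].
  apply/seteqP; split=> a /= h; first by split=> [i im|]; apply: h => //; exact: ltnW.
  by move=> i; rewrite ltnS leq_eqVlt => /predU1P[->|im]; [exact: h.2|exact: h.1].
by rewrite !E; apply: lsepI; [apply: lsep_widen IH|apply: lsep_widen lP];
  rewrite ?leq_maxl ?leq_maxr.
Qed.

End NamedVariables.

(** * Construction of generic sequences *)

Section OmittingTypes.
Variables (R : realType) (L : language R) (U : set_system nat).
Context {UU : UltraFilter U}.
Hypothesis oU : \oo `<=` U.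
Hypothesis hL : separable_language L.
Variable M : mstructure L.
Local Notation "M^U" := (ultrapower oU M).

Lemma Los_le n p (phi : formula L n) (psi : formula L p) (a : nat -> 'I_n -> M)
    (b : nat -> 'I_p -> M) (r : R) :
  (\forall k \near U, cval phi (a k) <= cval psi (b k) + r) ->
  cval phi (fun i => uclass oU (a ^~ i)) <= cval psi (fun i => uclass oU (b ^~ i)) + r.
Proof.
move=> ab; apply/ler_addgt0Pr => e e0; have e20 : 0 < e / 2 by exact: divr_gt0.
have /cvg_contractP /(_ _ e20) pa := @Los _ _ _ UU oU M _ phi a.
have /cvg_contractP /(_ _ e20) pb := @Los _ _ _ UU oU M _ psi b.
have [k [[]]] := filter_ex (filterI (filterI pa pb) ab).
rewrite /cval !ltr_norml => /andP[? ?] /andP[? ?] ?; lra.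
Qed.

Lemma lopen_ext k (Q : set (nat -> M)) a b : lopen k Q ->
  (forall i, (i < k)%N -> a i = b i) -> Q a -> Q b.
Proof.
move=> [F [phi phiP] FP] ab /FP; rewrite phiP => h; apply/FP; rewrite phiP.
by congr (cval _ _ < _): h; apply/funext => i; exact: ab.
Qed.

Lemma leq_nth_sumn (s : seq nat) i : (nth 0%N s i <= sumn s)%N.
Proof.
elim: s i => [|x s IH] [|i] //=; first by rewrite leq_addr.
by apply: leq_trans (IH i) _; rewrite leq_addl.
Qed.

Variables (x : nat -> M) (m : nat) (e : R).

(** No separable elementary submodel of [M^U] omits the type of [x]; categoricity will provide this.
    The list [s] names terms of the dense sequence that approximate a realisation. *)
Hypothesis realised : forall c : nat -> M^U, TarskiVaught c ->
  exists (s : seq nat) (y : nat -> M^U),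
    tp (restr (k:=m) y) = tp (restr (k:=m) x) /\
    forall i, (i < m)%N -> (dist (y i) (c (nth 0%N s i)) < e%:E)%E.

(** Forcing conditions: open constraints on finitely many terms of a sequence under construction.
    [avoids s A] forces the terms listed in [s] away from realisations of the type of [x], and
    [witness] forces one instance of the Tarski-Vaught test. *)
Let cond (A : set (nat -> M)) := (exists k, lopen k A) /\ A !=set0.

Let avoids (s : seq nat) (A : set (nat -> M)) := exists Q, [/\ lopen m Q, Q x &
  forall a y, A a -> Q y -> ~ close m e y (a \o nth 0%N s)].

Let witness n k l (s : seq nat) (A : set (nat -> M)) := exists j, forall a, A a ->
  forall y,
    cval (dense_formula hL n.+1 k) (tcons (a j) (fun i : 'I_n => a (nth 0%N s i))) <=
    cval (dense_formula hL n.+1 k) (tcons y (fun i : 'I_n => a (nth 0%N s i))) + l.+1%:R^-1.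

Lemma cond_witness n k l s A : cond A ->
  exists A', [/\ cond A', A' `<=` A & witness n k l s A'].
Proof.
move=> [[p oA] [a Aa]]; pose phi := dense_formula hL n.+1 k.
(* A fresh index: [A] constrains only variables below [p], and [sumn s] bounds every entry of [s],
   so redefining [a] at [j] disturbs neither. *)
pose j := (p + sumn s).+1; have d0 : 0 < (l.+1%:R^-1 : R) by rewrite invr_gt0.
have d1 : (l.+1%:R^-1 : R) <= 1 by rewrite invf_le1// ler1n.
set d := l.+1%:R^-1 in d0 d1.
have : cval (FInf phi) (fun i : 'I_n => a (nth 0%N s i)) <
  cval (FInf phi) (fun i : 'I_n => a (nth 0%N s i)) + d by rewrite ltrDl.
move=> /cval_inf_lt[y yP].
pose s' (i : 'I_n.+1) := if unlift ord0 i is Some t then nth 0%N s t else j.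
have [q1 l1] := ldef_cval M phi s'.
have [q2 l2] := ldef_cval M (FInf phi) (fun i : 'I_n => nth 0%N s i).
have tconsE (b : nat -> M) :
    (fun i => b (s' i)) = tcons (b j) (fun i : 'I_n => b (nth 0%N s i)).
  by apply/funext => i; rewrite /s' /tcons; case: unliftP.
have oB := lopen_lt d (ldef_conn2 (@nonexpansive_sub R)
  (ldef_widen (leq_maxl q1 q2) l1) (ldef_widen (leq_maxr q1 q2) l2)).
set B := [set _ | _] in oB.
exists (A `&` B); split => //.
- split.
    exists (maxn p (maxn q1 q2)); apply: lopenI.
      by apply: lopen_widen oA; rewrite leq_maxl.
    by apply: lopen_widen oB; rewrite leq_maxr.
  exists (upd a j y); split.
    apply: lopen_ext oA _ Aa => i ip; rewrite /upd ltn_eqF//.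
    by rewrite ltnS (leq_trans (ltnW ip))// leq_addr.
  have E : (fun i : 'I_n => upd a j y (nth 0%N s i)) = (fun i : 'I_n => a (nth 0%N s i)).
    apply/funext => i; rewrite /upd ltn_eqF// ltnS.
    by apply: leq_trans (leq_nth_sumn _ _) _; rewrite leq_addl.
  rewrite /B /mkset tconsE E /upd eqxx clamp_lt//; last by lra.
  by rewrite ltrBlDl.
- exists j => b [_]; rewrite /B /mkset tconsE clamp_lt//; last by lra.
  rewrite ltrBlDl => /ltW bd z; apply: le_trans bd _.
  by rewrite lerD2r; exact: eval_tcons_inf.
Qed.

(* Omitting types: otherwise a descending sequence of nonempty open sets [A_ j]
   meets every requirement, and the tuple of [M^U] represented by points of the
   [A_ j] generates an elementary submodel without realisation of the type of
   [x]. *)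
Lemma generic_set : exists A s, cond A /\ forall A', cond A' -> A' `<=` A -> ~ avoids s A'.
Proof.
apply: contrapT => nA.
have cond_avoids s A : cond A -> exists A', [/\ cond A', A' `<=` A & avoids s A'].
  move=> cA; apply: contrapT => nA'; apply: nA; exists A, s; split => // A' cA' A'A av.
  by apply: nA'; exists A'.
pose req := ((nat * nat * nat * seq nat) + seq nat)%type.
pose ok (r : req) A := match r with
  | inl (n, k, l, s) => witness n k l s A | inr s => avoids s A end.
have /choice[f fP] : forall z : req * set (nat -> M), exists A', cond z.2 ->
    [/\ cond A', A' `<=` z.2 & ok z.1 A'].
  move=> [r A]/=; have [cA|] := pselect (cond A); last by exists A.
  case: r => [[[[n k] l] s]|s] /=.
    by have [A' ?] := cond_witness n k l s cA; exists A'.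
  by have [A' ?] := cond_avoids s _ cA; exists A'.
(* Requirement [r] is met at stage [(pickle r).+1]; a stage that decodes to no requirement keeps the
   previous condition. *)
pose A_ := fix A_ j := if j is i.+1 then
  (if (unpickle i : option req) is Some r then f (r, A_ i) else A_ i) else setT.
have cA j : cond (A_ j).
  elim: j => [|j IH] /=.
    by split; [exists 0%N; exact: lopenT|exists x].
  by case: unpickle => [r|//]; have [] := fP (r, A_ j) IH.
have dA i j : A_ (i + j)%N `<=` A_ i.
  elim: j => [|j IH]; rewrite ?addn0// addnS /=.
  case: unpickle => [r|//].
  by apply: subset_trans IH; have [] := fP (r, A_ (i + j)%N) (cA _).
have okA r : exists i, ok r (A_ i).
  exists (pickle r).+1; rewrite /= pickleK.
  by have [] := fP (r, A_ (pickle r)) (cA _).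
have /choice[a aA] : forall j, exists a, A_ j a.
  by move=> j; have [_ [a Aa]] := cA j; exists a.
have nearA i : \forall k \near U, A_ i (a k).
  have : \forall k \near U, (i <= k)%N by apply: oU; exact: nbhs_infty_ge.
  apply: filterS => k ik; apply: (dA i (k - i)%N); rewrite subnKC//.
pose c i : M^U := @uclass R L U UU oU M (a ^~ i).
have [|s [y [ty yc]]] := realised (c:=c).
  refine (@dense_TarskiVaught _ _ hL _ _ c _) => n k l s.
  pose sq := [seq s i | i <- enum 'I_n].
  have sqE (i : 'I_n) : nth 0%N sq i = s i.
    by rewrite (nth_map i) ?size_enum_ord// nth_ord_enum.
  have [i0 [j jP]] := okA (inl (n, k, l, sq)); exists j => y.
  have E1 : tcons (c j) (c \o s) = fun i => uclass oU
      ((fun q => tcons (a q j) (fun i : 'I_n => a q (nth 0%N sq i))) ^~ i).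
    by apply/funext => i; rewrite /tcons; case: unliftP => [t _|_//]; rewrite sqE.
  have E2 : tcons y (c \o s) = fun i => uclass oU
      ((fun q => tcons (useq y q) (fun i : 'I_n => a q (nth 0%N sq i))) ^~ i).
    apply/funext => i; rewrite /tcons; case: unliftP => [t _|_]; rewrite ?sqE//.
    by rewrite useqK.
  rewrite E1 E2; apply: Los_le; apply: filterS (nearA i0).
  by move=> q Aq; exact: jP.
(* The realisation [y] contradicts this requirement: both the neighbourhood [Q] of the type and the
   distance bound pass to almost every coordinate. *)
have [i0 [Q [[F [phi phiP] FQ] Qx Qa]]] := okA (inr s).
have yQ : \forall k \near U, Q (fun i => useq (y i) k).
  have : (eval phi (restr (k:=m) y) < 0)%E.
    move/tp_eq: ty => ->; rewrite -lt_contract contract0 -/(cval _ _) -phiP.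
    exact/FQ.
  rewrite Los_useq => /ulim_lt; apply: filterS => k h; apply/FQ; rewrite phiP.
  by rewrite /cval -(contract0 R) lt_contract.
have yca : \forall k \near U, close m e (fun i => useq (y i) k) (a k \o nth 0%N s).
  have : \forall k \near U, forall i : 'I_m,
      (dist (useq (y i) k) (a k (nth 0%N s i)) < e%:E)%E.
    apply: near_forall_fin => i; apply: ulim_lt.
    by have := yc i (ltn_ord i); rewrite -{1}[y i]useqK [dist _ _]udist_ucl.
  by apply: filterS => k h i im; exact: (h (Ordinal im)).
have [k [[Qk ck] Ak]] := filter_ex (filterI (filterI yQ yca) (nearA i0)).
exact: Qa Ak Qk ck.
Qed.

End OmittingTypes.

(** * Approximate isolation and the back-and-forth step *)

Section BackAndForth.
Variables (R : realType) (L : language R) (M : mstructure L).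
Implicit Types (a b c x y : nat -> M) (A Q : set (nat -> M)).

Definition nearby (m : nat) (e : R) (s t : nat -> nat) A : set (nat -> M) :=
  [set y : nat -> M | exists2 a, A a & close m e (y \o s) (a \o t)].

(** Storing the point [a] in the variables from [p] on turns the quantification over [A] into a
    projection, under which open and separated conditions are stable. *)
Lemma nearby_mix p m e s t A : (forall i, (i < m)%N -> (s i < p)%N) ->
  nearby m e s t A = [set y : nat -> M | exists z, (A (mix p y z \o addn p)) /\
    close m e (mix p y z \o s) (mix p y z \o (addn p \o t))].
Proof.
move=> sp; apply/seteqP; split=> y /=.
  move=> [a Aa ya]; exists (fun i => a (i - p)%N).
  have -> : mix p y (fun i => a (i - p)%N) \o addn p = a.
    by apply/funext => i; rewrite /= /mix ltnNge leq_addr/= addKn.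
  split => // i im; rewrite /= /mix sp// ltnNge leq_addr/= addKn; exact: ya.
move=> [z [Az yz]]; exists (mix p y z \o addn p) => // i im.
by have := yz i im; rewrite /= {1}/mix sp.
Qed.

Lemma lopen_nearby k p m e s t A : (forall i, (i < m)%N -> (s i < p)%N) ->
  lopen k A -> lopen p (nearby m e s t A).
Proof.
move=> sp oA; rewrite (nearby_mix _ _ _ sp).
have [k1 o1] := lopen_comp (addn p) oA.
have [k2 o2] := lopen_close M m s (addn p \o t) e.
exact: (lopen_proj p (lopenI (lopen_widen (leq_maxl k1 k2) o1)
  (lopen_widen (leq_maxr k1 k2) o2))).
Qed.

Lemma lsep_nearby k p m e e' s t A' A : (forall i, (i < m)%N -> (s i < p)%N) ->
  e < e' -> lsep k A' A -> lsep p (nearby m e s t A') (nearby m e' s t A).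
Proof.
move=> sp ee oA; rewrite !(nearby_mix _ _ _ sp).
have [k1 o1] := lsep_comp (addn p) oA.
have [k2 o2] := lsep_close M m s (addn p \o t) ee.
exact: (lsep_proj p (lsepI (lsep_widen (leq_maxl k1 k2) o1)
  (lsep_widen (leq_maxr k1 k2) o2))).
Qed.

Lemma lsep_sub k A' A : lsep k A' A -> A' `<=` A.
Proof. by move=> [F _ [s s01 FP]] a /(FP a).1 h; apply: (FP a).2; lra. Qed.

Lemma close_sym k e a b : close k e a b -> close k e b a.
Proof. by move=> ab i ik; rewrite distC; exact: ab. Qed.

Lemma close_trans k e1 e2 b a c : close k e1 a b -> close k e2 b c ->
  close k (e1 + e2) a c.
Proof. by move=> ab bc i ik; exact: dist_lt_tri (ab i ik) (bc i ik). Qed.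

(* [tclose k a b e]: the types of the [k]-tuples [a] and [b] are at distance at
   most [e]. *)
Definition tclose k a b (e : R) := forall Q, lopen k Q -> Q a ->
  exists2 b', close k e b b' & Q b'.

(** If no point of [Q] were within [e * 2] of [a], an open set [Qc] around [a] would consist of
    tuples with no point of [Q1] within [e]; closeness puts a point of [Qc] within [e] of [b],
    although [b] lies in [Q1]. The factor 2 pays for the open complement. *)
Lemma tclose_sym k a b e : 0 < e -> tclose k a b e -> tclose k b a (e * 2).
Proof.
move=> e0 ab Q oQ Qb; have [Q1 [oQ1 Q1b sQ]] := lopen_regular oQ Qb.
have sp i : (i < k)%N -> (id i < k)%N by [].
have ee : e < e * 2 by lra.
have [Qc oQc QcP] := lsep_compl (lsep_nearby id sp ee sQ).
have [Qca|] := pselect (Qc a); last by move/(QcP a).2 => -[y]; exists y.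
have [b' bb' Qcb'] := ab _ oQc Qca; exfalso; apply: (QcP b').1 Qcb'.
by exists b => //; exact: close_sym.
Qed.

(** Positive form of [generic_set]: no nonempty open part of [A] keeps [a \o s] away from the type
    of [x]. *)
Hypothesis generic : forall m x (e : R), 0 < e -> exists A (s : nat -> nat),
  [/\ exists k, lopen k A, A !=set0 & forall k A' Q, lopen k A' -> A' !=set0 ->
    A' `<=` A -> lopen m Q -> Q x ->
    exists a y, [/\ A' a, Q y & close m e y (a \o s)]].

(** The neighbourhood consists of the tuples near some [a \o s] with [a] in the generic set.
    Genericity excludes both an open set around [x] that stays away from them and an open part of
    [A] whose tuples [a \o s] stay away from [Q]. Each of the two comparisons costs [e * 2]. *)
Lemma isolated_tuples m x (e : R) : 0 < e -> exists Q,
  [/\ lopen m Q, Q x & forall c, Q c -> tclose m x c (e * 4)].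
Proof.
move=> e0; have [A [s [[k oA] [a0 Aa0] gA]]] := generic m x e0.
have [A1 [oA1 A1a0 sA]] := lopen_regular oA Aa0.
have sp i : (i < m)%N -> (id i < m)%N by [].
have ee : e < e * 2 by lra.
exists (nearby m (e * 2) id s A); split.
- exact: lopen_nearby oA.
- have [Qc oQc QcP] := lsep_compl (lsep_nearby s sp ee sA).
  have [Qcx|/(QcP x).2//] := pselect (Qc x).
  have [||a [y [A1a Qcy ya]]] := gA _ A1 Qc oA1 _ _ oQc Qcx; first by exists a0.
    exact: lsep_sub sA.
  by exfalso; apply: (QcP y).1 Qcy; exists a.
move=> c [a Aa ca] Q oQ Qx; have [Q1 [oQ1 Q1x sQ]] := lopen_regular oQ Qx.
pose p := (\max_(i < m) s i).+1.
have sp' i : (i < m)%N -> (s i < p)%N.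
  by move=> im; rewrite ltnS; exact: (@leq_bigmax _ (fun i : 'I_m => s i) (Ordinal im)).
have [Zc oZc ZcP] := lsep_compl (lsep_nearby id sp' ee sQ).
have [Zca|/(ZcP a).2 [y Qy ay]] := pselect (Zc a); last first.
  exists y => //; have -> : e * 4 = e * 2 + e * 2 by lra.
  exact: close_trans ca ay.
have [|||a' [y [[Aa' Zca'] Q1y ya']]] := gA (maxn k p) (A `&` Zc) Q1 _ _ _ oQ1 Q1x.
- by apply: lopenI; [apply: lopen_widen oA|apply: lopen_widen oZc];
    rewrite ?leq_maxl ?leq_maxr.
- by exists a.
- by move=> ? [].
by exfalso; apply: (ZcP a').1 Zca'; exists y => //; exact: close_sym.
Qed.

(** The old coordinates move by [e], but isolation of the extended tuple makes the new bound [e'] as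
    small as desired, so displacements over successive stages can be made summable. *)
Lemma forth k a b (e e' : R) u : 0 < e' -> tclose k a b e ->
  exists2 b', close k e b b' & tclose k.+1 (upd a k u) b' e'.
Proof.
move=> e'0 ab; have e40 : 0 < e' / 4 by exact: divr_gt0.
have [Q [oQ Qa QP]] := isolated_tuples k.+1 (upd a k u) e40.
have [|b1 bb1 [z Qz]] := ab _ (lopen_proj k oQ).
  exists (upd a k u); apply: lopen_ext oQ _ Qa => i; rewrite ltnS /mix /upd => ik.
  by case: ltnP => [ik'|//]; rewrite ltn_eqF.
exists (mix k b1 z); last by have := QP _ Qz; rewrite divfK.
by move=> i ik; rewrite /mix ik; exact: bb1.
Qed.

Lemma back_and_forth k a b (e : R) u : 0 < e -> tclose k a b e -> exists a' b',
  [/\ close k e a a', close k e b b', (dist u (a' k) < e%:E)%E, b' k.+1 = u &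
    tclose k.+2 a' b' (e / 2)].
Proof.
move=> e0 ab; have e20 : 0 < e / 2 by exact: divr_gt0.
have e40 : 0 < e / 4 by exact: divr_gt0.
(* The bounds [e / 2] and [e / 4] absorb the doubling in [tclose_sym], so that a full round halves
   [e]. *)
have [b1 bb1 /(tclose_sym e20)] := forth u e20 ab; rewrite divfK// => ba1.
have [a' aa' /(tclose_sym e40)] := forth u e40 ba1.
have -> : e / 4 * 2 = e / 2 by lra.
exists a', (upd b1 k.+1 u); split => //.
- by move=> i ik; have := aa' i (ltnW ik); rewrite /upd ltn_eqF.
- by move=> i ik; rewrite /upd ltn_eqF ?ltnS ?(ltnW ik)//; exact: bb1.
- by have := aa' k (ltnSn k); rewrite /upd eqxx.
- by rewrite /upd eqxx.
Qed.

(** A coordinate exists only from some stage [t0] on. The tail of the series is twice its first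
    term, and one further term covers the passage to the limit, whence the factor 3. *)
Lemma geometric_limit (u : nat -> M) (e : R) t0 : 0 < e ->
  (forall t, (t0 <= t)%N -> (dist (u t) (u t.+1) < (e * 2^-1 ^+ t)%:E)%E) ->
  exists l, forall t, (t0 <= t)%N -> (dist (u t) l < (e * 2^-1 ^+ t * 3)%:E)%E.
Proof.
move=> e0 ue; pose E t : R := e * 2^-1 ^+ t.
have E0 t : 0 < E t by rewrite mulr_gt0// exprn_gt0// invr_gt0.
have ES t : E t.+1 = E t / 2 by rewrite /E exprSr mulrA.
have uE t s : (t0 <= t)%N -> (dist (u t) (u (t + s)%N) < (E t * 2)%:E)%E.
  move=> tt; suff : (dist (u t) (u (t + s)%N) <= (E t * 2 - E (t + s)%N * 2)%:E)%E.
    by move/le_lt_trans; apply; rewrite lte_fin; have := E0 (t + s)%N; lra.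
  elim: s => [|s IH]; first by rewrite addn0 subrr distxx.
  apply: le_trans (dist_tri _ (u (t + s)%N) _) _; rewrite addnS.
  apply: le_trans (leeD IH (ltW (ue _ _))) _; first by rewrite (leq_trans tt)// leq_addr.
  by rewrite -EFinD lee_fin -/(E _) ES; lra.
have Esmall r : 0 < r -> exists2 t, (t0 <= t)%N & E t * 4 < r.
  move=> r0; have r40 : 0 < r / 4 / e by rewrite !divr_gt0.
  have := cvg_geometric 1 (_ : `|(2^-1 : R)| < 1).
  rewrite gtr0_norm ?invr_gt0// invf_lt1// ltr1n => /(_ isT) /cvgrPdist_lt /(_ _ r40).
  move=> H; have [t [tt]] := filter_ex (filterI (nbhs_infty_ge t0) H).
  rewrite /= sub0r normrN mul1r gtr0_norm ?exprn_gt0 ?invr_gt0// => h.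
  exists t => //; rewrite /E; move: h; rewrite ltr_pdivlMr// ltr_pdivlMr//; lra.
have [|l lP] := dist_complete (u := u).
  move=> r /Esmall[t tt tr]; exists t => j k tj tk.
  have -> : r = (r / 2) + r / 2 by rewrite -splitr.
  apply: (@dist_lt_tri _ _ _ (u t)); [rewrite distC|].
    by rewrite -(subnKC tj); apply: lt_trans (uE _ _ tt) _; rewrite lte_fin; lra.
  by rewrite -(subnKC tk); apply: lt_trans (uE _ _ tt) _; rewrite lte_fin; lra.
exists l => t tt; have [m /(_ (t + m)%N (leq_addl _ _)) ml] := lP _ (E0 t).
have := dist_lt_tri (uE _ m tt) ml; rewrite -/(E t).
by have -> : E t * 2 + E t = E t * 3 by lra.
Qed.

End BackAndForth.

(** * Automorphisms from dense sequences of the same type *)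

Section DenseIsomorphism.
Variables (R : realType) (L : language R).

Lemma elementary_isomorphism (N N' : mstructure L) (f : N -> N') :
  elementary f -> bijective f -> isomorphism f.
Proof.
move=> ef bf; split => // [x y|s x|r x].
- exact: elementary_dist.
- pose phi := FDist (TVar L (ord0 : 'I_(fun_ar s).+1))
    (TApp (fun i => TVar L (lift ord0 i))).
  have E (N0 : mstructure L) (y : N0) (a : 'I_(fun_ar s) -> N0) :
      eval phi (tcons y a) = dist y (fun_interp N0 s a).
    rewrite /=; congr dist; first by rewrite /tcons unlift_none.
    by congr fun_interp; apply/funext => i; rewrite /tcons liftK.
  have := ef _ phi (tcons (fun_interp N s x) x).
  by rewrite tcons_comp !E distxx => /dist_eq0.
- by have := ef _ (FRel (fun i : 'I_(rel_ar r) => TVar L i)) x.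
Qed.

Variable M : mstructure L.

Definition dense_seq (A : nat -> M) :=
  forall x (e : R), 0 < e -> exists i, (dist (A i) x < e%:E)%E.

Definition same_type (A B : nat -> M) :=
  forall n (phi : formula L n) (s : 'I_n -> nat), eval phi (A \o s) = eval phi (B \o s).

Lemma same_type_sym A B : same_type A B -> same_type B A.
Proof. by move=> AB n phi s; rewrite AB. Qed.

Lemma same_type_dist A B i j : same_type A B -> dist (A i) (A j) = dist (B i) (B j).
Proof.
move=> AB; pose phi := FDist (TVar L (ord0 : 'I_2)) (TVar L (lift ord0 ord0)).
exact: (AB _ phi (fun t => if t == ord0 then i else j)).
Qed.

(** Closure of the set of pairs of [A i] and [B i]: the graph of the automorphism that extends the
    correspondence. *)
Definition matched (A B : nat -> M) (x y : M) := forall e : R, 0 < e ->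
  exists i, (dist (A i) x < e%:E)%E /\ (dist (B i) y < e%:E)%E.

Lemma matched_sym A B x y : matched A B x y -> matched B A y x.
Proof. by move=> xy e /xy[i [? ?]]; exists i. Qed.

Lemma matched_self A B i : matched A B (A i) (B i).
Proof. by move=> e e0; exists i; rewrite !distxx lte_fin. Qed.

Lemma matched_total A B x : same_type A B -> dense_seq A -> exists y, matched A B x y.
Proof.
move=> AB dA.
have /choice[i iP] : forall t : nat, exists i, (dist (A i) x < (t.+1%:R^-1)%:E)%E.
  by move=> t; apply: dA; rewrite invr_gt0.
have iC t s (e : R) : t.+1%:R^-1 < e / 2 -> s.+1%:R^-1 < e / 2 ->
    (dist (B (i t)) (B (i s)) < e%:E)%E.
  move=> te se; rewrite -(same_type_dist _ _ AB); apply: (@dist_lt_split _ _ _ x).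
    by apply: lt_trans (iP t) _; rewrite lte_fin.
  by rewrite distC; apply: lt_trans (iP s) _; rewrite lte_fin.
have le_inv (m j : nat) (r : R) : m.+1%:R^-1 < r -> (m <= j)%N -> j.+1%:R^-1 < r.
  by move=> mr mj; apply: le_lt_trans mr; rewrite lef_pV2 ?posrE// ler_nat.
have [|y yP] := dist_complete (u := B \o i).
  move=> e e0; have e20 : 0 < e / 2 by exact: divr_gt0.
  have [m me] := filter_ex (inv_nat_lt e20).
  by exists m => j k mj mk; apply: iC; exact: le_inv me _.
exists y => e e0; have [m1 m1P] := yP e e0; have [m2 m2e] := filter_ex (inv_nat_lt e0).
exists (i (maxn m1 m2)); split; last by apply: m1P; exact: leq_maxl.
by apply: lt_trans (iP _) _; rewrite lte_fin; apply: le_inv m2e _; exact: leq_maxr.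
Qed.

Lemma matched_eval A B n (phi : formula L n) (y z : 'I_n -> M) : same_type A B ->
  (forall i, matched A B (y i) (z i)) -> eval phi y = eval phi z.
Proof.
move=> AB yz; apply: cval_inj; apply/eqP; rewrite -subr_eq0 -normr_le0.
apply/ler_addgt0Pr => e e0; rewrite add0r.
have e20 : 0 < e / 2 by exact: divr_gt0.
have [d d0 dP] := cval_uc phi e20.
have /choice[s sP] : forall i, exists j,
    (dist (A j) (y i) < d%:E)%E /\ (dist (B j) (z i) < d%:E)%E by move=> i; exact: yz.
have := dP _ _ _ (fun i => (sP i).1); have := dP _ _ _ (fun i => (sP i).2).
have -> : cval phi (fun i => B (s i)) = cval phi (fun i => A (s i)).
  by rewrite /cval; congr contract; symmetry; exact: AB.
move=> h1 h2; apply/ltW; rewrite distrC in h2.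
by apply: ltr_dist_add h2 h1 _; rewrite -splitr.
Qed.

Lemma matched_dist A B x y x' y' : same_type A B -> matched A B x x' -> matched A B y y' ->
  dist x y = dist x' y'.
Proof.
move=> AB xx yy; pose phi := FDist (TVar L (ord0 : 'I_2)) (TVar L (lift ord0 ord0)).
apply: (@matched_eval A B _ phi (fun t => if t == ord0 then x else y)
  (fun t => if t == ord0 then x' else y')) => // t.
by case: ifP.
Qed.

Lemma dense_isomorphism A B : same_type A B -> dense_seq A -> dense_seq B ->
  exists g : Aut M, forall x, matched A B x (g x).
Proof.
move=> AB dA dB.
have /choice[g gP] : forall x, exists y, matched A B x y.
  by move=> x; exact: matched_total.
have /choice[h hP] : forall y, exists x, matched A B x y.
  move=> y; have [x xy] := matched_total y (same_type_sym AB) dB.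
  by exists x; exact: matched_sym.
have eg : elementary g.
  by move=> n phi a; symmetry; apply: matched_eval AB _ => i; exact: gP.
suff ig : isomorphism g by exists (MkAut ig).
apply: elementary_isomorphism => //; exists h => [x|y].
  by apply: dist_eq0; rewrite (matched_dist AB (hP (g x)) (gP x)) distxx.
by apply: dist_eq0; rewrite -(matched_dist AB (gP (h y)) (hP y)) distxx.
Qed.

End DenseIsomorphism.

(** * Approximate homogeneity *)

Section Homogeneity.
Variables (R : realType) (L : language R) (M : mstructure L).
Hypothesis sM : separable_structure M.
Hypothesis generic : forall m x (e : R), 0 < e -> exists A (s : nat -> nat),
  [/\ exists k, lopen k A, A !=set0 & forall k A' Q, @lopen R L M k A' -> A' !=set0 ->
    A' `<=` A -> lopen m Q -> Q x ->
    exists a y, [/\ A' a, Q y & close m e y (a \o s)]].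

(** The point [u i] is repeated at all [t] for which [t.+1] has 2-adic valuation [i], hence
    infinitely often. Density of the limit sequences needs this, since stage [t] reaches [v t] only
    up to an error that decreases with [t]. *)
Lemma dense_recurrent : exists v : nat -> M, forall x (e : R) t0, 0 < e ->
  exists2 t, (t0 <= t)%N & (dist (v t) x < e%:E)%E.
Proof.
have [u uP] := sM; exists (fun t => u (logn 2 t.+1)) => x e t0 e0.
have [i ix] := uP x e e0.
have t1 : (2 ^ i * (2 * t0).+1).-1.+1 = (2 ^ i * (2 * t0).+1)%N.
  by rewrite prednK// muln_gt0 expn_gt0.
exists (2 ^ i * (2 * t0).+1).-1.
  rewrite -ltnS t1; apply: leq_trans (leq_pmull _ _); last by rewrite expn_gt0.
  by rewrite ltnS leq_pmull.
rewrite t1 lognM ?expn_gt0// pfactorK// lognE /=.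
by rewrite dvdn2 /= oddM /= addn0.
Qed.

Lemma tclose_extends n a b (e : R) : 0 < e -> tclose n a b e ->
  exists A B : nat -> M, [/\ same_type A B, dense_seq A, dense_seq B,
    close n (e * 3) a A & close n (e * 3) b B].
Proof.
move=> e0 ab; have [v vP] := dense_recurrent.
pose E t : R := e * 2^-1 ^+ t.
have E0 t : 0 < E t by rewrite mulr_gt0// exprn_gt0// invr_gt0.
have ES t : E t.+1 = E t / 2 by rewrite /E exprSr mulrA.
(* Keeping closeness as a premise makes [f] total, so that [st] is a plain recursion; [stP] then
   shows that the premise always holds. *)
have /choice[f fP] : forall z : nat * ((nat -> M) * (nat -> M)), exists w,
    tclose (n + 2 * z.1) z.2.1 z.2.2 (E z.1) ->
    [/\ close (n + 2 * z.1) (E z.1) z.2.1 w.1, close (n + 2 * z.1) (E z.1) z.2.2 w.2,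
      (dist (v z.1) (w.1 (n + 2 * z.1)%N) < (E z.1)%:E)%E,
      w.2 (n + 2 * z.1).+1 = v z.1 &
      tclose (n + 2 * z.1.+1) w.1 w.2 (E z.1.+1)].
  move=> [t [a' b']]/=; have [h|nh] := pselect (tclose (n + 2 * t) a' b' (E t)); last first.
    by exists (a', b') => /nh.
  have [a1 [b1 [? ? ? ? ?]]] := back_and_forth generic (v t) (E0 t) h.
  exists (a1, b1) => _; split => //; rewrite ES.
  by have -> : (n + 2 * t.+1)%N = (n + 2 * t).+2 by lia.
pose st := fix st t := if t is s.+1 then f (s, st s) else (a, b).
have stP t : tclose (n + 2 * t) (st t).1 (st t).2 (E t).
  elim: t => [|t IH]; first by rewrite muln0 addn0 /E expr0 mulr1.
  by have [] := fP (t, st t) IH.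
have step t := fP (t, st t) (stP t).
have t0P i : exists t0, forall t, (i < n + 2 * t)%N = (t0 <= t)%N.
  by exists ((i.+2 - n) %/ 2)%N => t; lia.
have lim (p : (nat -> M) * (nat -> M) -> nat -> M) :
    (forall t, close (n + 2 * t) (E t) (p (st t)) (p (st t.+1))) ->
    exists A, forall t i, (i < n + 2 * t)%N -> (dist (p (st t) i) (A i) < (E t * 3)%:E)%E.
  move=> cl; have /choice[A AP] : forall i, exists l, forall t, (i < n + 2 * t)%N ->
      (dist (p (st t) i) l < (E t * 3)%:E)%E.
    move=> i; have [t0 t0E] := t0P i.
    have [|l lP] := @geometric_limit _ _ _ (fun t => p (st t) i) e t0 e0.
      by move=> t tt; apply: cl; rewrite t0E.
    by exists l => t; rewrite t0E; exact: lP.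
  by exists A => t i; exact: AP.
have [A AP] := lim fst (fun t => let: And5 h _ _ _ _ := step t in h).
have [B BP] := lim snd (fun t => let: And5 _ h _ _ _ := step t in h).
have Esmall r : 0 < r -> exists t0, forall t, (t0 <= t)%N -> E t * 4 < r.
  move=> r0; have r40 : 0 < r / 4 / e by rewrite !divr_gt0.
  have := cvg_geometric 1 (_ : `|(2^-1 : R)| < 1).
  rewrite gtr0_norm ?invr_gt0// invf_lt1// ltr1n => /(_ isT) /cvgrPdist_lt /(_ _ r40).
  move=> [t0 _ H]; exists t0 => t /H.
  rewrite /= sub0r normrN mul1r gtr0_norm ?exprn_gt0 ?invr_gt0// => h.
  rewrite /E; move: h; rewrite ltr_pdivlMr// ltr_pdivlMr//; lra.
exists A, B; split.
- move=> p phi s; apply: cval_inj; apply/eqP; rewrite -subr_eq0 -normr_le0.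
  apply/ler_addgt0Pr => r r0; rewrite add0r.
  (* Four comparisons: [A] with the first tuple of stage [t], this one with the tuple [b'] given by
     closeness, [b'] with the second tuple of the stage, and the latter with [B]. *)
  have r40 : 0 < r / 4 by exact: divr_gt0.
  have [d d0 dP] := cval_uc phi r40.
  have [k kP] := ldef_cval M phi s.
  have [t0 t0d] := Esmall d d0.
  pose t := maxn t0 (maxn k (\max_i s i).+1).
  have kt : (k <= n + 2 * t)%N by rewrite /t; lia.
  have st' i : (s i < n + 2 * t)%N.
    have : (s i < (\max_i s i).+1)%N by rewrite ltnS; exact: leq_bigmax.
    by rewrite /t; lia.
  have td := t0d t (leq_maxl _ _); have Et := E0 t.
  pose al := cval phi (fun i => (st t).1 (s i)).
  have o1 := lopen_widen kt (lopen_lt (al + r / 4) kP).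
  have o2 := lopen_widen kt (lopen_gt (al - r / 4) kP).
  have [|b' bb' [/= h1 h2]] := stP t _ (lopenI o1 o2).
    by split; rewrite /mkset -/al; lra.
  have hA : `|al - cval phi (A \o s)| < r / 4.
    apply: dP => i; apply: lt_le_trans (AP t _ (st' i)) _.
    by rewrite lee_fin; lra.
  have hB : `|cval phi (fun i => (st t).2 (s i)) - cval phi (B \o s)| < r / 4.
    apply: dP => i; apply: lt_le_trans (BP t _ (st' i)) _.
    by rewrite lee_fin; lra.
  have hb : `|cval phi (fun i => (st t).2 (s i)) - cval phi (fun i => b' (s i))| < r / 4.
    apply: dP => i; apply: lt_le_trans (bb' _ (st' i)) _.
    by rewrite lee_fin; lra.
  move: hA hB hb; rewrite !ltr_norml => /andP[? ?] /andP[? ?] /andP[? ?].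
  by apply/ltW; rewrite ltr_norml; apply/andP; split; lra.
- move=> y r r0; have r20 : 0 < r / 2 by exact: divr_gt0.
  have [t0 t0r] := Esmall _ r20.
  have [t tt vy] := vP y _ t0 r20; exists (n + 2 * t)%N.
  have [_ _ hv _ _] := step t.
  have hA := AP t.+1 (n + 2 * t)%N (_ : (n + 2 * t < n + 2 * t.+1)%N).
  apply: (@dist_lt_split _ _ _ (v t)) => //; rewrite distC.
  apply: lt_trans (dist_lt_tri hv (hA _)) _; first by lia.
  by rewrite lte_fin ES; have := t0r t tt; have := E0 t; lra.
- move=> y r r0; have r20 : 0 < r / 2 by exact: divr_gt0.
  have [t0 t0r] := Esmall _ r20.
  have [t tt vy] := vP y _ t0 r20; exists (n + 2 * t).+1.
  have [_ _ _ hv _] := step t.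
  have hB := BP t.+1 (n + 2 * t).+1 (_ : ((n + 2 * t).+1 < n + 2 * t.+1)%N).
  apply: (@dist_lt_split _ _ _ (v t)) => //; rewrite distC -[X in dist X _]hv.
  apply: lt_trans (hB _) _; first by lia.
  by rewrite lte_fin ES; have := t0r t tt; have := E0 t; lra.
- by move=> i ni; have := AP 0%N i; rewrite muln0 addn0 /E expr0 mulr1; exact.
- by move=> i ni; have := BP 0%N i; rewrite muln0 addn0 /E expr0 mulr1; exact.
Qed.

Lemma homogeneity n x (e : R) : 0 < e -> exists Q,
  [/\ lopen n Q, Q x & forall c, Q c -> exists g : Aut M, close n e (g \o x) c].
Proof.
(* [isolated_tuples] multiplies the error by 4, [tclose_extends] by 3, and both tuples move: 24 is 4
   * 3 * 2. *)
move=> e0; have e60 : 0 < e / 24 by exact: divr_gt0.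
have [Q [oQ Qx QP]] := isolated_tuples generic n x e60.
exists Q; split => // c /QP xc; have e40 : 0 < e / 24 * 4 by lra.
have [A [B [AB dA dB xA cB]]] := tclose_extends e40 xc.
have [g gP] := dense_isomorphism AB dA dB; exists g => i ni.
have h : (dist (g (x i)) (B i) < (e / 24 * 4 * 3)%:E)%E.
  by rewrite -(matched_dist AB (gP (x i)) (matched_self A B i)); exact: xA.
have := cB i ni; rewrite distC => /(dist_lt_tri h).
by have -> : e / 24 * 4 * 3 + e / 24 * 4 * 3 = e by lra.
Qed.

End Homogeneity.

(** * Local categoricity *)

Section Categoricity.
Variables (R : realType) (L : language R) (M : mstructure L).
Hypothesis hM : locally_aleph0_categorical M.
Local Notation T := (Th M).
Implicit Types N : mstructure L.

Lemma lac_language : separable_language L.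
Proof. by have [[]] := hM. Qed.

Lemma lac_separable : separable_structure M.
Proof. by have [] := hM. Qed.

Lemma lac_loc (a b : M) : loc T a b.
Proof. by have [_ _ []] := hM. Qed.

Lemma loc_refl N (a : N) : model T N -> loc T a a.
Proof. by have [[_ + _ _ _] _ _] := hM; move=> /[apply] -[]. Qed.

Lemma loc_sym N (a b : N) : model T N -> loc T a b -> loc T b a.
Proof. by have [[_ + _ _ _] _ _] := hM; move=> /[apply] -[_ + _]; apply. Qed.

Lemma loc_trans N (b a c : N) : model T N -> loc T a b -> loc T b c -> loc T a c.
Proof. by have [[_ + _ _ _] _ _] := hM; move=> /[apply] -[_ _ +]; apply. Qed.

Lemma loc_elementary N N' (f : N -> N') (a b : N) : elementary f ->
  loc T (f a) (f b) <-> loc T a b.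
Proof. by move=> ef; rewrite /loc -comp_pair2 elementary_tp. Qed.

(** The dense sequence of [N'] may miss the image of [f], so a point of the image is chosen in each
    small ball around its terms that contains one. *)
Lemma separable_elementary N N' (f : N -> N') : elementary f ->
  separable_structure N' -> separable_structure N.
Proof.
move=> ef [u uP]; have [x0] := carrier_inhabited N.
have /choice[w wP] : forall z : nat * nat, exists x : N,
    (exists y, (dist (f y) (u z.1) < (z.2.+1%:R^-1)%:E)%E) ->
    (dist (f x) (u z.1) < (z.2.+1%:R^-1)%:E)%E.
  move=> z.
  have [[y yz]|] := pselect (exists y, (dist (f y) (u z.1) < (z.2.+1%:R^-1)%:E)%E).
    by exists y.
  by exists x0.
exists (fun k => if unpickle k is Some z then w z else x0) => x e e0.
have e20 : 0 < e / 2 by exact: divr_gt0.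
have [m me] := filter_ex (inv_nat_lt e20).
have m0 : 0 < m.+1%:R^-1 :> R by rewrite invr_gt0.
have [k kx] := uP (f x) _ m0; exists (pickle (k, m)); rewrite pickleK.
have h : (dist (f (w (k, m))) (u k) < (m.+1%:R^-1)%:E)%E.
  by apply: wP; exists x; rewrite distC.
rewrite -(elementary_dist _ _ ef); apply: (@dist_lt_split _ _ _ (u k)).
  by apply: lt_trans h _; rewrite lte_fin.
by apply: lt_trans kx _; rewrite lte_fin.
Qed.

(** The class of [a] is the image of a model that is local, as loc passes through elementary maps,
    and separable, as [N] is; uniqueness identifies this model with [M]. *)
Lemma component_copy N (a : N) : model T N -> separable_structure N ->
  exists2 s : M -> N, elementary s & range s = [set b | loc T a b].
Proof.
move=> mN sN; have [[_ _ hcl _ [_ huniq]] sM lM] := hM.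
have [N1 [f [ef fa]]] := hcl N mN a.
have mN1 : model T N1 by apply/(elementary_Th T ef).
have lN1 : local_model T N1.
  split => // x y; apply/(loc_elementary _ _ ef); apply: (@loc_trans _ a) => //.
    by apply: loc_sym => //; have : range f (f x) by []; rewrite fa.
  by have : range f (f y) by []; rewrite fa.
have [g ig] := huniq _ _ sM lM (separable_elementary ef sN) lN1.
exists (f \o g); first by apply: elementary_comp ef; exact: isomorphism_elementary.
rewrite -fa; apply/seteqP; split=> _ [x _ <-]; first by exists (g x).
by have [[h gK hK] _ _ _] := ig; exists (h x) => //=; rewrite hK.
Qed.

(** [N] need not be separable, so a separable elementary submodel through the tuple is taken first;
    [p] is added to serve as base point of the component. *)
Lemma local_tuple_type N n (p : N) (a : 'I_n -> N) : model T N ->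
  (forall i, loc T p (a i)) -> exists x : 'I_n -> M, tp x = tp a.
Proof.
move=> mN pa.
have [N0 [f [ef sN0 [b fb]]]] := Lowenheim_Skolem lac_language (tcons p a).
have mN0 : model T N0 by apply/(elementary_Th T ef).
have fb0 : f (b ord0) = p by rewrite -[f _]/((f \o b) ord0) fb /tcons unlift_none.
have fbS i : f (b (lift ord0 i)) = a i.
  by rewrite -[f _]/((f \o b) (lift ord0 i)) fb /tcons liftK.
have [s es rs] := component_copy (b ord0) mN0 sN0.
have /choice[x xP] : forall i, exists x, s x = b (lift ord0 i).
  move=> i; have : [set c | loc T (b ord0) c] (b (lift ord0 i)).
    by apply/(loc_elementary _ _ ef); rewrite fb0 fbS.
  by rewrite -rs => -[x _ <-]; exists x.
exists x; rewrite -(elementary_tp x es) -(elementary_tp (s \o x) ef).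
by congr tp; apply/funext => i; rewrite /= xP fbS.
Qed.

(** The closure of the sequence [c] is a separable model; any of its components is a copy of [M] and
    so contains a copy of [x]. Thus the type of [x] cannot be omitted. *)
Lemma lac_generic m x (e : R) : 0 < e -> exists A (s : nat -> nat),
  [/\ exists k, lopen k A, A !=set0 & forall k A' Q, @lopen R L M k A' -> A' !=set0 ->
    A' `<=` A -> lopen m Q -> Q x ->
    exists a y, [/\ A' a, Q y & close m e y (a \o s)]].
Proof.
move=> e0; have [U UU oU] := free_ultrafilter.
have [|A [s [[oA A0] gA]]] := @generic_set R L U UU oU lac_language M x m e.
  move=> c TV; pose N := substructure TV.
  have mN : model T N.
    apply: (elementary_Th T (sub_incl_elementary TV)).2.
    exact/ultrapower_model/Th_model.
  have [a0] := carrier_inhabited N.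
  have [f ef _] := component_copy a0 mN (substructure_separable TV).
  pose y i := sub_incl (f (x i)).
  have /choice[j jP] : forall i, exists j, (dist (y i) (c j) < e%:E)%E.
    by move=> i; have [j] := sub_incl_closure (f (x i)) e0; exists j; rewrite distC.
  exists (mkseq j m), y; split; last by move=> i im; rewrite nth_mkseq.
  by rewrite -(elementary_tp _ ef) -(elementary_tp _ (sub_incl_elementary TV)).
exists A, (nth 0%N s); split => // k A' Q oA' A'0 A'A oQ Qx.
apply: contrapT => nay; apply: (gA A' _ A'A); first by split => //; exists k.
exists Q; split => // a y A'a Qy ya; apply: nay; by exists a, y.
Qed.

Lemma lac_homogeneity n (x : 'I_n -> M) (e : R) : 0 < e ->
  exists2 phi : formula L n, cval phi x < 0 & forall c, cval phi c < 0 ->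
    exists g : Aut M, forall i, (dist (g (x i)) (c i) < e%:E)%E.
Proof.
move=> e0; have [x0] := carrier_inhabited M.
pose ext (y : 'I_n -> M) i := if insub i is Some j then y j else x0.
have extK y : restr (ext y) = y.
  by apply/funext => i; rewrite /restr /ext valK.
have [Q [[F [phi phiP] FQ] Qx QP]] := homogeneity lac_separable lac_generic n (ext x) e0.
exists phi; first by rewrite -(extK x) -phiP; exact/FQ.
move=> c c0; have [|g gP] := QP (ext c); first by apply/FQ; rewrite phiP extK.
by exists g => i; have := gP i (ltn_ord i); rewrite /= /ext valK.
Qed.

End Categoricity.

Section ContinuousPredicates.
Variables (R : realType) (L : language R) (M : mstructure L).
Local Notation T := (Th M).
Implicit Types N : mstructure L.

Lemma types_tp N n (a : 'I_n -> N) : model T N -> types T (tp a).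
Proof. by move=> mN; exists N; split => //; exists a. Qed.

Lemma types_cvg n (V : topologicalType) (Pt : ptype L n -> V) S (F : set_system S)
    {FF : Filter F} (N : mstructure L) (a : S -> 'I_n -> N) p : model T N ->
  {within types T (n := n), continuous Pt} -> types T p ->
  (fun k => tp (a k)) @ F --> p -> (fun k => Pt (tp (a k))) @ F --> Pt p.
Proof.
move=> mN /subspace_continuousP Pc Tp ap W PW.
have h := ap _ (Pc _ Tp W PW).
by apply: (@filterS _ F _ _ _ _ h) => k /=; apply; exact: types_tp.
Qed.

Lemma ultra_types_cvg (U : set_system nat) {UU : UltraFilter U} (oU : \oo `<=` U)
    n (V : topologicalType) (F : ptype L n -> V) (a : nat -> 'I_n -> M) :
  {within types T (n := n), continuous F} ->
  (fun k => F (tp (a k))) @ U --> F (tp (fun i => uclass oU (a ^~ i))).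
Proof.
move=> Fc; apply: (types_cvg (@Th_model _ _ M) Fc _ (@Los_tp R L U UU oU M n a)).
exact/types_tp/ultrapower_model/Th_model.
Qed.

End ContinuousPredicates.

(** * Definability *)

Section Density.
Variables (R : realType) (L : language R) (M : mstructure L).
Local Notation T := (Th M).
Implicit Types N : mstructure L.

Fixpoint inf_closure n : formula L n -> formula L 0 :=
  match n with 0%N => id | k.+1 => fun phi => inf_closure (FInf phi) end.

Lemma cval_inf_closure N n (phi : formula L n) (a0 : 'I_0 -> N) (r : R) :
  cval (inf_closure phi) a0 < r <-> exists a : 'I_n -> N, cval phi a < r.
Proof.
elim: n phi => [|n IH] phi.
  split=> [h|[a]]; first by exists a0.
  by have -> : a = a0 by apply/funext => -[].
rewrite IH; split=> [[a /cval_inf_lt[x h]]|[a h]]; first by exists (tcons x a).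
exists (a \o lift ord0); apply/cval_inf_lt; exists (a ord0).
have -> // : tcons (a ord0) (a \o lift ord0) = a.
by apply/funext => i; rewrite /tcons; case: unliftP => [j|] ->.
Qed.

(** The theory records only sentences of value 0; shifting by the value [r] in [M] encodes all
    others. *)
Lemma Th_cval N (phi : formula L 0) (a : 'I_0 -> N) (b : 'I_0 -> M) : model T N ->
  cval phi a = cval phi b.
Proof.
move=> mN; pose r := cval phi b.
have E (N' : mstructure L) (c : 'I_0 -> N') :
    eval (fconn2 (@nonexpansive_shift R r) phi phi) c = expand (cval phi c - r) by [].
have : T (fconn2 (@nonexpansive_shift R r) phi phi).
  move=> c; rewrite E /r; have -> : c = b by apply/funext => -[].
  by rewrite subrr expand0.
move=> /mN /(_ a); rewrite E => /(congr1 (@contract R)).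
rewrite contract_expand contract0 -/r.
have [[_ ->]|[_ ->]|[_ ->]] := clampP (cval phi a - r); lra.
Qed.

(** The conditions [cval phi a < 0] generate a filter, and it converges pointwise to the type of [c]
    because the absolute difference [h] is available as a connective. *)
Lemma formula_nbhs N n (c : 'I_n -> N) (O : set (ptype L n)) : nbhs (tp c) O ->
  exists2 phi : formula L n, cval phi c < 0 &
    forall N' (a : 'I_n -> N'), cval phi a < 0 -> O (tp a).
Proof.
pose B : set_system (ptype L n) := [set O | exists2 phi : formula L n, cval phi c < 0 &
    forall N' (a : 'I_n -> N'), cval phi a < 0 -> O (tp a)].
have FB : Filter B.
  split.
  - pose zero := FInf (FDist (TVar L (ord0 : 'I_n.+1)) (TVar L ord0)).
    exists (fconn2 (@nonexpansive_shift R 2) zero zero) => //.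
    rewrite cval_conn2 clamp_lt//; have := contract_le1 (eval zero c).
    by rewrite -/(cval _ _) ler_norml => /andP[? ?]; lra.
  - move=> O1 O2 [p1 p1c p1P] [p2 p2c p2P].
    exists (fconn2 (@nonexpansive_max R) p1 p2).
      by rewrite cval_conn2 clamp_lt// gt_max p1c.
    move=> N' a; rewrite cval_conn2 clamp_lt// gt_max => /andP[? ?].
    by split; [exact: p1P|exact: p2P].
  - by move=> O1 O2 O12 [p p0 pP]; exists p => // N' a /pP /O12.
suff : B --> tp c by apply.
have : (fun q : ptype L n => q) @ B --> tp c; last by [].
apply/ptws_cvgP => psi; apply/cvg_contractP => e e0.
pose h (x y : R) := `|x - cval psi c| - e.
have hh : nonexpansive h.
  move=> x y x' y'; rewrite /h opprB addrA subrK.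
  apply: le_trans (ler_dist_dist _ _) _.
  by rewrite opprB addrA subrK lerDl.
exists (fconn2 hh psi psi).
  by rewrite cval_conn2 clamp_lt// /h subrr normr0; lra.
by move=> N' a; rewrite cval_conn2 clamp_lt// /h subr_lt0.
Qed.

Lemma types_dense n (p : ptype L n) (O : set (ptype L n)) : types T p -> nbhs p O ->
  exists a : 'I_n -> M, O (tp a).
Proof.
move=> [N [mN [c ->]]] /formula_nbhs[phi c0 phiP].
have [x0] := carrier_inhabited M.
pose e0 (i : 'I_0) : M := x0; have [x1] := carrier_inhabited N.
have : cval (inf_closure phi) (fun=> x1) < 0 by apply/cval_inf_closure; exists c.
rewrite (Th_cval _ _ e0 mN) => /cval_inf_closure[a a0]; exists a; exact: phiP.
Qed.

End Density.

Section Uniform.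
Variable K : uniformType.

Lemma entourage_sym_split (V : set (K * K)) : entourage V -> exists V1,
  [/\ entourage V1, forall x y, V1 (x, y) -> V1 (y, x) &
    forall x y z, V1 (x, y) -> V1 (y, z) -> V (x, z)].
Proof.
move=> eV; exists (split_ent V `&` (split_ent V)^-1%relation); split.
- by apply: filterI; [|apply: entourage_inv]; exact: entourage_split_ent.
- by move=> x y [].
- by move=> x y z [h _] [h' _]; apply: entourage_split h h'.
Qed.

Lemma hausdorff_entourage (x y : K) : hausdorff_space K ->
  (forall V, entourage V -> V (x, y)) -> x = y.
Proof. by move=> hK xy; apply: close_eq => //; rewrite entourage_close. Qed.

End Uniform.

Section Extension.
Variables (R : realType) (L : language R) (M : mstructure L) (K : uniformType).
Variables (n : nat) (P : ('I_n -> M) -> K).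
Hypothesis hKc : compact [set: K].
Hypothesis hKh : hausdorff_space K.
Local Notation T := (Th M).

(** Extension by continuity from the dense set of types realised in [M]: compactness provides
    limits, and the Hausdorff property makes them agree with [P] on realised types. *)
Lemma definable_of_cauchy :
  (forall p V, types T p -> entourage V -> exists2 B0, nbhs p B0 &
    forall a b, B0 (tp a) -> B0 (tp b) -> V (P a, P b)) -> definable P.
Proof.
move=> PC; have [x0] := carrier_inhabited M.
have /choice[Pt PtP] : forall p, exists l, types T p -> forall V, entourage V ->
    exists2 B0, nbhs p B0 & forall a, B0 (tp a) -> V (P a, l).
  move=> p; have [Tp|nTp] := pselect (types T p); last by exists (P (fun=> x0)) => /nTp.
  pose F : set_system ('I_n -> M) := [set A | exists2 B0, nbhs p B0 &
    forall a, B0 (tp a) -> A a].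
  have FF : ProperFilter F.
    split.
      by move=> [B0 pO F0]; have [a Oa] := types_dense Tp pO; exact: F0 Oa.
    split.
    - by exists setT => //; exact: filterT.
    - move=> A B [B1 p1 A1] [B2 p2 A2]; exists (B1 `&` B2); first exact: filterI.
      by move=> a [/A1 ? /A2 ?].
    - by move=> A B AB [B1 p1 A1]; exists B1 => // a /A1/AB.
  have [l [_ cl]] := hKc (fmap_proper_filter P FF) (@filterT _ _ FF : F (P @^-1` setT)).
  exists l => _ V /entourage_sym_split[V1 [eV1 V1s V1V]].
  have [B0 pO OV] := PC p V1 Tp eV1; exists B0 => // a Oa.
  have [||y [/= [b Ob <-] lb]] := cl (P @` [set a | B0 (tp a)]) (xsection V1 l).
  - by exists B0 => // b Ob; exists b.
  - by apply: nbhs_entourage.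
  apply: V1V (OV _ _ Oa Ob) _; apply: V1s; by move: lb; rewrite /xsection/= inE.
exists Pt; split; last first.
  move=> a; apply: hausdorff_entourage => // V.
  have Ta : types T (tp a) by exact/types_tp/Th_model.
  by move=> /(PtP _ Ta)[B0 /nbhs_singleton Oa]; apply.
apply/subspace_continuousP => p Tp W.
rewrite -nbhs_entourageE => -[V eV VW].
have [V1 [eV1 V1s V1V]] := entourage_sym_split eV.
have [B0 pO OV] := PtP _ Tp _ eV1.
have := nbhs_interior pO; apply: filterS => q qO Tq; apply: VW => /=.
have [B0' qO' OV'] := PtP _ Tq _ eV1.
have [a [Oa Oa']] := types_dense Tq (filterI qO qO').
rewrite /xsection/= inE; apply: V1V (OV' _ Oa'); apply: V1s; exact: OV.
Qed.

End Extension.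

(** * The localising metric in [M] and in its ultrapower *)

Section LocalisingMetric.
Variables (R : realType) (L : language R) (M : mstructure L).
Hypothesis hM : locally_aleph0_categorical M.
Local Notation T := (Th M).
Variable d : ptype L 2 -> \bar R.
Hypothesis hd : localising_metric T d.
Implicit Types N : mstructure L.

Definition ldist N (a b : N) : \bar R := interp2 d a b.

Lemma ldistxx N (a : N) : model T N -> ldist a a = 0%E.
Proof. by move=> /hd.2[[_ h _ _] _]; apply/h. Qed.

Lemma ldistC N (a b : N) : model T N -> ldist a b = ldist b a.
Proof. by move=> /hd.2[[_ _ h _] _]; exact: h. Qed.

Lemma ldist_tri N (b a c : N) : model T N -> (ldist a c <= ldist a b + ldist b c)%E.
Proof. by move=> /hd.2[[_ _ _ h] _]; exact: h. Qed.

Lemma ldist_ge0 N (a b : N) : model T N -> (0 <= ldist a b)%E.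
Proof. by move=> /hd.2[[h _ _ _] _]; exact: h. Qed.

Lemma ldist_loc N (a b : N) : model T N -> (ldist a b < +oo)%E <-> loc T a b.
Proof. by move=> /hd.2[_ h]; exact: h. Qed.

Lemma ldist_elementary N N' (f : N -> N') a b : elementary f ->
  ldist (f a) (f b) = ldist a b.
Proof. by move=> ef; rewrite /ldist /interp2 -comp_pair2 elementary_tp. Qed.

Lemma aut_elementary (g : Aut M) : elementary g.
Proof. exact/isomorphism_elementary/aut_isomorphism. Qed.

Section Ultra.
Variable U : set_system nat.
Context {UU : UltraFilter U}.
Hypothesis oU : \oo `<=` U.

Lemma ultra_ldist (a b : nat -> M) :
  (fun k => ldist (a k) (b k)) @ U --> ldist (uclass oU a) (uclass oU b).
Proof.
have := @ultra_types_cvg R L M U UU oU 2 _ d (fun k => pair2 (a k) (b k)) hd.1.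
have -> // : (fun i => uclass oU ((fun k => pair2 (a k) (b k)) ^~ i)) =
  pair2 (uclass oU a) (uclass oU b).
by apply/funext => -[[|[|//]] i]; rewrite /pair2 !(tnth_nth (uclass oU a));
  congr uclass; apply/funext => k; rewrite (tnth_nth (a k)).
Qed.

Lemma ultra_ldist_gt (a b : nat -> M) (r : R) : ~ loc T (uclass oU a) (uclass oU b) ->
  \forall k \near U, (r%:E < ldist (a k) (b k))%E.
Proof.
have mU : model T (ultrapower oU M) by exact/ultrapower_model/Th_model.
move=> /(ldist_loc _ _ mU) /negP; rewrite -leNgt leye_eq => /eqP h.
have := @ultra_ldist a b; rewrite h => /ulim_eqP abo.
by apply: ulim_gt; rewrite abo ltry.
Qed.

End Ultra.

(** Pairs whose distance tends to 0 while [ldist] stays above 1 would define a single point of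
    [M^U], whose [ldist] to itself is 0. *)
Lemma ldist_small : exists2 e : R, 0 < e &
  forall a b : M, (dist a b < e%:E)%E -> (ldist a b <= 1%:E)%E.
Proof.
apply: contrapT => ne; have [U UU oU] := free_ultrafilter.
have /choice[ab abP] : forall k : nat, exists ab : M * M,
    (dist ab.1 ab.2 < (k.+1%:R^-1)%:E)%E /\ (1%:E < ldist ab.1 ab.2)%E.
  move=> k; apply: contrapT => nab; apply: ne; exists k.+1%:R^-1 => // a b ab.
  by rewrite leNgt; apply/negP => ab1; apply: nab; exists (a, b).
have E : uclass oU (fun k => (ab k).1) = uclass oU (fun k => (ab k).2).
  apply: uclass_dist_small => e e0; apply: filterS (oU _ (inv_nat_lt e0)) => k ke.
  by apply: lt_trans (abP k).1 _; rewrite lte_fin.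
have := @ultra_ldist U UU oU (fun k => (ab k).1) (fun k => (ab k).2).
rewrite E ldistxx; last exact/ultrapower_model/Th_model.
move=> /ulim_eqP h.
have : (ulim U (fun k => ldist (ab k).1 (ab k).2) < 1%:E)%E by rewrite h lte_fin.
move=> /ulim_lt /filter_ex[k]; rewrite ltNge => /negP; apply.
exact/ltW/(abP k).2.
Qed.

Variable dL : Aut M -> Aut M -> R.
Hypothesis hdLd : coarsely_compatible (@interp2 R L d M) dL.

(** On the path from [a q] to [b q] through [g q y], [h q y] and [h q z], the end segments cost at
    most 1 each, and the segment inside [h q] costs [ldist y z], finite since [M] is one component;
    the remaining segment must tend to infinity. The bound [q./2] is suited to two interleaved
    sequences. *)
Lemma translates_apart (e : R) (g h : nat -> Aut M) (y z : M) (a b : nat -> M) :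
  (forall x x' : M, (dist x x' < e%:E)%E -> (ldist x x' <= 1%:E)%E) ->
  (forall q, (dist (g q y) (a q) < e%:E)%E) ->
  (forall q, (dist (h q z) (b q) < e%:E)%E) ->
  (forall q, ((q./2)%:R%:E < ldist (a q) (b q))%E) ->
  dL (g q) (h q) @[q --> \oo] --> +oo.
Proof.
move=> e1 ga hb ab; have mM : model T M by exact: Th_model.
apply/hdLd; exists y; apply/cvgeyPge => A.
have yz : (ldist y z < +oo)%E by apply/ldist_loc => //; exact: lac_loc.
have yz0 := ldist_ge0 y z mM; set C := ldist y z in yz yz0.
have bound q : (ldist (a q) (b q) <= ldist (g q y) (h q y) + (C + 2%:E))%E.
  apply: le_trans (ldist_tri (g q y) _ _ mM) _.
  rewrite (_ : 2%:E = 1%:E + 1%:E)%E; last by rewrite -EFinD.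
  rewrite addeA addeA addeC; apply: leeD; first by rewrite ldistC//; exact: e1.
  apply: le_trans (ldist_tri (h q y) _ _ mM) _; rewrite -addeA leeD2l//.
  apply: le_trans (ldist_tri (h q z) _ _ mM) _.
  by apply: leeD; [rewrite ldist_elementary//; exact: aut_elementary|exact: e1].
move: C yz yz0 bound => [c| |]// _ _ bound.
have [m mA] : exists m : nat, A + c + 2 <= m%:R.
  by exists (Num.truncn (A + c + 2)).+1; exact/ltW/truncnS_gt.
exists (m.*2)%N => // q /= mq.
have mq2 : (m <= q./2)%N by rewrite -(doubleK m) half_leq.
have := le_trans (ltW (ab q)) (bound q); rewrite -/(ldist _ _).
have Ac : ((A + c + 2)%R%:E = A%:E + (c%:E + 2%:E))%E by rewrite -!EFinD; congr EFin; ring.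
move=> le; rewrite -(@leeD2rE _ (c%:E + 2%:E)%E)// -Ac.
by apply: le_trans le; rewrite lee_fin (le_trans mA)// ler_nat.
Qed.

End LocalisingMetric.

(** * From proper invariance to definability *)

Section ProperImpliesDefinable.
Local Open Scope quotient_scope.
Variables (R : realType) (L : language R) (M : mstructure L).
Hypothesis hM : locally_aleph0_categorical M.
Local Notation T := (Th M).
Variable d : ptype L 2 -> \bar R.
Hypothesis hd : localising_metric T d.
Variable dL : Aut M -> Aut M -> R.
Hypothesis hdLd : coarsely_compatible (@interp2 R L d M) dL.
Variables (K : uniformType) (n : nat) (P : ('I_n -> M) -> K).
Hypothesis hPu : predicate_unif_continuous P.
Hypothesis hPi : properly_invariant dL P.

(* By density of the formulas [dense_formula], the logic topology is first
   countable, so that a failure of the Cauchy condition at a type is witnessed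
   by sequences; those have the same limit in an ultrapower. *)
Lemma bad_sequences (V : set (K * K)) (p : ptype L n) : types T p ->
  ~ (exists2 O, nbhs p O & forall a b, O (tp a) -> O (tp b) -> V (P a, P b)) ->
  exists a b : nat -> 'I_n -> M, [/\ forall k, ~ V (P (a k), P (b k)),
    (fun k => tp (a k)) @ \oo --> p & (fun k => tp (b k)) @ \oo --> p].
Proof.
move=> [N [mN [c ->]]] nV; pose u := dense_formula (lac_language hM) n.
pose W k : set (ptype L n) := [set q | forall j : 'I_k.+1,
  `|contract (q (u j)) - cval (u j) c| < k.+1%:R^-1].
have /choice[ab abP] : forall k, exists ab : ('I_n -> M) * ('I_n -> M),
    [/\ W k (tp ab.1), W k (tp ab.2) & ~ V (P ab.1, P ab.2)].
  move=> k; apply: contrapT => nab; apply: nV; exists (W k).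
    suff : \forall q \near tp c, forall j : 'I_k.+1,
      `|contract (q (u j)) - cval (u j) c| < k.+1%:R^-1 by [].
    refine (@near_forall_fin _ (nbhs (tp c : ptype L n)) _ 'I_k.+1 (fun j q =>
      `|contract (q (u j)) - cval (u j) c| < k.+1%:R^-1) _) => j.
    have h : (fun q : ptype L n => q (u j)) @ nbhs (tp c) --> tp c (u j).
      apply: ((@ptws_cvgP _ _ _ (nbhs (tp c)) _ (fun w => w) (tp c)).1 _ (u j)).
      exact: cvg_id.
    by move/cvg_contractP: h; apply; rewrite invr_gt0.
  move=> a b Wa Wb; apply: contrapT => nVab; apply: nab; by exists (a, b).
exists (fun k => (ab k).1), (fun k => (ab k).2); split; first by move=> k; have [] := abP k.
- apply/ptws_cvgP => phi; apply/cvg_contractP => e e0.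
  have e30 : 0 < e / 3 by exact: divr_gt0.
  have [j jP] := dense_formulaP (lac_language hM) phi e30.
  have := nbhs_infty_ge j; apply: filterS2 (inv_nat_lt e30) => k ke jk.
  have [/(_ (Ordinal (jk : (j < k.+1)%N))) /=] := abP k.
  move=> /lt_trans /(_ ke) h1 _ _; have h2 := jP _ (ab k).1; have h3 := jP _ c.
  move: h1 h2 h3; rewrite -/(u j) /cval /tp !ltr_norml => /andP[? ?] /andP[? ?] /andP[? ?].
  by apply/andP; split; lra.
- apply/ptws_cvgP => phi; apply/cvg_contractP => e e0.
  have e30 : 0 < e / 3 by exact: divr_gt0.
  have [j jP] := dense_formulaP (lac_language hM) phi e30.
  have := nbhs_infty_ge j; apply: filterS2 (inv_nat_lt e30) => k ke jk.
  have [_ /(_ (Ordinal (jk : (j < k.+1)%N))) /=] := abP k.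
  move=> /lt_trans /(_ ke) h1 _; have h2 := jP _ (ab k).2; have h3 := jP _ c.
  move: h1 h2 h3; rewrite -/(u j) /cval /tp !ltr_norml => /andP[? ?] /andP[? ?] /andP[? ?].
  by apply/andP; split; lra.
Qed.

Section Limits.
Variable U : set_system nat.
Context {UU : UltraFilter U}.
Hypothesis oU : \oo `<=` U.
Variables (a : nat -> 'I_n -> M) (p : ptype L n).
Hypothesis ap : (fun k => tp (a k)) @ \oo --> p.

Definition ulimit (i : 'I_n) : ultrapower oU M := uclass oU (a ^~ i).

Lemma tp_ulimit : tp ulimit = p.
Proof.
apply/funext => phi; apply: (@ultra_cvg_unique R _ U UU (fun k => eval phi (a k))).
  exact: Los.
have := (@ptws_cvgP _ _ _ \oo _ (fun k => tp (a k)) p).1 ap phi.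
by move=> h W /h; exact: oU.
Qed.

Lemma ulimit_neg (phi : formula L n) : contract (p phi) < 0 ->
  \forall k \near U, cval phi (a k) < 0.
Proof.
move=> p0; have h : (fun k => tp (a k) phi) @ \oo --> p phi.
  exact: ((@ptws_cvgP _ _ _ \oo _ (fun k => tp (a k)) p).1 ap phi).
have e0 : 0 < - contract (p phi) by lra.
move/cvg_contractP: h => /(_ _ e0) /oU; apply: filterS => k.
by rewrite ltr_norml /cval /tp => /andP[? ?]; lra.
Qed.

End Limits.

(** Allows the partition into components found for the limit of one sequence to be used for another
    with the same limit type. *)
Lemma loc_tp (N N' : mstructure L) (i j : 'I_n) (a : 'I_n -> N) (a' : 'I_n -> N') :
  tp a = tp a' -> loc T (a i) (a j) <-> loc T (a' i) (a' j).
Proof.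
move=> aa; rewrite /loc.
suff -> : tp (pair2 (a i) (a j)) = tp (pair2 (a' i) (a' j)) by [].
apply/tp_eq => phi.
have E (N0 : mstructure L) (b : 'I_n -> N0) : eval phi (pair2 (b i) (b j)) =
    eval (formula_rename phi (fun t : 'I_2 => if t == ord0 then i else j)) b.
  rewrite eval_rename; congr eval; apply/funext => -[[|[|//]] t];
  by rewrite /pair2 (tnth_nth (b i)).
by rewrite !E; move/tp_eq: aa.
Qed.

Lemma proper_cauchy (p : ptype L n) (V : set (K * K)) : types T p -> entourage V ->
  exists2 O, nbhs p O & forall a b, O (tp a) -> O (tp b) -> V (P a, P b).
Proof.
move=> Tp eV; apply: contrapT => /(bad_sequences Tp)[a [b [nV ap bp]]].
have [U UU oU] := free_ultrafilter.
have mU : model T (ultrapower oU M) by exact/ultrapower_model/Th_model.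
have tpa := @tp_ulimit U UU oU a p ap; set al := ulimit oU a in tpa.
pose r (i j : 'I_n) := `[< loc T (al i) (al j) >].
have r_refl : reflexive r by move=> i; apply/asboolP; exact: (loc_refl hM).
have r_sym : symmetric r.
  by move=> i j; apply/asboolP/asboolP; exact: (loc_sym hM).
have r_trans : transitive r.
  by move=> j i k /asboolP ij /asboolP jk; apply/asboolP; exact: (loc_trans hM mU ij jk).
pose e : equiv_rel 'I_n := EquivRel r r_refl r_sym r_trans.
(* [al \o s j] keeps the coordinates in the class of [j] and replaces the others by coordinate [j];
   it lies in one component, so its type is realised in [M]. *)
pose s j i := if r j i then i else j.
have /choice[x xP] : forall j, exists x : 'I_n -> M, tp x = tp (al \o s j).
  move=> j; apply: (local_tuple_type hM (p := al j) mU) => i.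
  by rewrite /s /=; case: ifP => [/asboolP//|_]; exact: (loc_refl hM).
pose cl i := repr (\pi_({eq_quot e}) i).
have clP i : r (cl i) i.
  by rewrite r_sym; apply/(@eqquotP _ e {eq_quot e}); rewrite reprK.
pose X i := x (cl i) i.
have [e1 e10 e1P] := ldist_small hd.
have [V1 [eV1 V1s V1V]] := entourage_sym_split eV.
have [V2 [eV2 V2s V2V]] := entourage_sym_split eV1.
have [de de0 deP] := hPu eV2.
(* [e1] keeps errors in [ldist] within 1, and [de] keeps values of [P] within [V2]. *)
pose ep := Num.min e1 de.
have ep0 : 0 < ep by rewrite lt_min e10.
(* The tuples [x j] come from the limit of [a], but only their types matter: they serve equally for
   [b]. *)
have near_aut (c : nat -> 'I_n -> M) : (fun k => tp (c k)) @ \oo --> p ->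
    \forall k \near U, forall j : 'I_n, exists g : Aut M,
      forall i, (dist (g (x j i)) (c k (s j i)) < ep%:E)%E.
  move=> cp; apply: near_forall_fin => j.
  have [phi phi0 phiP] := lac_homogeneity hM (x j) ep0.
  have : contract (p (formula_rename phi (s j))) < 0.
    rewrite -tpa /tp eval_rename.
    by have /tp_eq <- := xP j.
  move=> /(ulimit_neg oU cp); apply: filterS => k.
  by rewrite /cval eval_rename => /phiP[g gP]; exists g => i; exact: gP.
have near_far (c : nat -> 'I_n -> M) (m : nat) : (fun k => tp (c k)) @ \oo --> p ->
    \forall k \near U, forall ij : 'I_n * 'I_n, ~~ r ij.1 ij.2 ->
      (m%:R%:E < ldist d (c k ij.1) (c k ij.2))%E.
  move=> cp; apply: near_forall_fin => -[i j] /=.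
  have [rij|/asboolPn nij] := boolP (r i j); first exact: nearW.
  have : ~ loc T (ulimit oU c i) (ulimit oU c j).
    by move=> h; apply: nij; apply/(loc_tp i j _).2: h; rewrite tpa (tp_ulimit oU cp).
  by move=> /(ultra_ldist_gt hd m%:R); apply: filterS.
have /choice[kgh kghP] : forall m : nat,
  exists z : nat * (('I_n -> Aut M) * ('I_n -> Aut M)),
    [/\ forall j i, (dist (z.2.1 j (x j i)) (a z.1 (s j i)) < ep%:E)%E,
      forall j i, (dist (z.2.2 j (x j i)) (b z.1 (s j i)) < ep%:E)%E,
      forall i j, ~~ r i j -> (m%:R%:E < ldist d (a z.1 i) (a z.1 j))%E &
      forall i j, ~~ r i j -> (m%:R%:E < ldist d (b z.1 i) (b z.1 j))%E].
  move=> m; have [k [[/choice[g gP] fa] [/choice[h hP] fb]]] := filter_ex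
    (filterI (filterI (near_aut a ap) (near_far a m ap))
      (filterI (near_aut b bp) (near_far b m bp))).
  exists (k, (g, h)); split => //= i j; first exact: (fa (i, j)).
  exact: (fb (i, j)).
(* Interleaving the two sequences forces the limits of [P] to agree. *)
pose tup q := if odd q then b (kgh q./2).1 else a (kgh q./2).1.
pose G q j := if odd q then (kgh q./2).2.2 j else (kgh q./2).2.1 j.
have GP q j i : (dist (G q j (x j i)) (tup q (s j i)) < ep%:E)%E.
  by rewrite /G /tup; have [h1 h2 _ _] := kghP q./2; case: odd.
have GF q i j : ~~ r i j -> ((q./2)%:R%:E < ldist d (tup q i) (tup q j))%E.
  by rewrite /tup; have [_ _ h1 h2] := kghP q./2; case: odd; [exact: h2|exact: h1].
have ta : @tends_apart R L M dL n e (fun q I => G q (repr I)).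
  move=> I J IJ.
  have nr : ~~ r (repr I) (repr J).
    apply: contra IJ => /(@eqquotP _ e {eq_quot e}); rewrite !reprK => ->.
    by rewrite eqxx.
  apply: (translates_apart hM hd hdLd (e := ep) (y := x (repr I) (repr I))
    (z := x (repr J) (repr J)) (a := tup ^~ (repr I)) (b := tup ^~ (repr J))).
  - move=> y y' yy; apply: e1P; apply: lt_le_trans yy _.
    by rewrite lee_fin ge_min lexx.
  - by move=> q; have := GP q (repr I) (repr I); rewrite /s r_refl.
  - by move=> q; have := GP q (repr J) (repr J); rewrite /s r_refl.
  - by move=> q; exact: GF.
have [l Pl] := hPi X ta.
have close_tup q : V2 (P (@class_act R L M n e (fun I => G q (repr I)) X), P (tup q)).
  apply: deP; apply/max_dist_ltP => // i.
  have := GP q (cl i) i; rewrite /s clP /class_act => h.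
  by apply: lt_le_trans h _; rewrite lee_fin ge_min lexx orbT.
have Vl : \forall q \near \oo, V2 (P (@class_act R L M n e (fun I => G q (repr I)) X), l).
  apply: (@filterS _ \oo _ _ _ _ (Pl _ (nbhs_entourage l eV2))) => q.
  by rewrite /xsection/= inE => /V2s.
(* [q0.*2] and [q0.*2.+1] have the same half, so they compare [a] and [b] at one and the same bad
   index. *)
have [q0 _ q0P] := Vl.
apply: (nV (kgh q0).1).
have E0 : tup q0.*2 = a (kgh q0).1 by rewrite /tup odd_double doubleK.
have E1 : tup q0.*2.+1 = b (kgh q0).1 by rewrite /tup /= odd_double /= uphalf_double.
rewrite -E0 -E1; apply: (V1V _ l).
  by apply: V2V (q0P q0.*2 _); [apply: V2s; exact: close_tup|rewrite /= -addnn leq_addr].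
apply: V1s; apply: V2V (q0P q0.*2.+1 _); first by apply: V2s; exact: close_tup.
by rewrite /= -addnn leqW// leq_addr.
Qed.

End ProperImpliesDefinable.

(** Each new value is corrected by a transposition of two points of [S]. This turns a matching of
    finitely many components into an injection on all of them, as a globally elementary map
    requires. *)
Lemma extend_injection (X : Type) (I : eqType) (S : set X) (f f' : I -> X) (l : seq I) :
  injective f -> injective f' -> (forall i, S (f i)) -> (forall i, S (f' i)) ->
  exists t : X -> X, [/\ injective t, forall x, S x -> S (t x) &
    forall i, i \in l -> t (f i) = f' i].
Proof.
move=> fI f'I Sf Sf'; elim: l => [|i l [t [tI St tf]]].
  by exists id; split => // x y.
have [il|il] := boolP (i \in l).
  by exists t; split => // j; rewrite inE => /predU1P[->|]; exact: tf.
pose u := t (f i); pose v := f' i.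
pose sw x := if `[< x = u >] then v else if `[< x = v >] then u else x.
have swu : sw u = v by rewrite /sw asboolT.
have swv : sw v = u.
  by rewrite /sw; case: asboolP => // _; rewrite asboolT.
have swo x : x <> u -> x <> v -> sw x = x by move=> xu xv; rewrite /sw !asboolF.
have swK : involutive sw.
  move=> x; have [->|xu] := pselect (x = u); first by rewrite swu.
  by have [->|xv] := pselect (x = v); [rewrite swv|rewrite !swo].
exists (sw \o t); split.
- by move=> x y /= /(can_inj swK) /tI.
- move=> x Sx /=; have [->|xu] := pselect (t x = u); first by rewrite swu; exact: Sf'.
  have [->|xv] := pselect (t x = v); first by rewrite swv; apply/St/Sf.
  by rewrite swo//; exact: St.
- move=> j; rewrite inE => /predU1P[->//|jl] /=.
  have ji : j <> i by move=> ji; rewrite -ji jl in il.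
  by rewrite (tf _ jl) swo// -(tf _ jl) => [/tI/fI//|]; rewrite (tf _ jl) => /f'I.
Qed.

(** * From definability to uniform continuity and proper invariance *)

Section DefinableImpliesProper.
Local Open Scope quotient_scope.
Variables (R : realType) (L : language R) (M : mstructure L).
Hypothesis hM : locally_aleph0_categorical M.
Local Notation T := (Th M).
Implicit Types N : mstructure L.

(* Pieces of an elementary map prescribed component by component: [sg s]
   identifies [M] with the component of [s], and [et s] is the prescribed image
   of that component. *)
Lemma glue_components N0 N1 (io : N0 -> N1) (r t : N0 -> N0) (sg : N0 -> M -> N0)
    (et : N0 -> M -> N1) :
  model T N0 -> model T N1 -> elementary io ->
  (forall y, loc T y (r y)) -> (forall y z, loc T y z -> r y = r z) ->
  (forall s, elementary (sg s) /\ range (sg s) = [set b | loc T s b]) ->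
  injective t -> (forall s, r s = s -> r (t s) = t s) ->
  (forall s, elementary (et s)) ->
  (forall s m, r s = s -> loc T (io (t s)) (et s m)) ->
  forall n (s : 'I_n -> N0) (m : 'I_n -> M), (forall i, r (s i) = s i) ->
  tp (fun i => et (s i) (m i)) = tp (fun i => sg (s i) (m i)).
Proof.
move=> m0 m1 eio yr ry sgP tI tr eet eloc.
have rr y : r (r y) = r y by symmetry; apply: ry.
have sgl s x : loc T s (sg s x).
  by have : range (sg s) (sg s x) by []; rewrite (sgP s).2.
have /choice[iv ivP] : forall y, exists x, sg (r y) x = y.
  move=> y; have : [set b | loc T (r y) b] y by exact: (loc_sym hM).
  by rewrite -(sgP (r y)).2 => -[x _ xy]; exists x.
(* [iv y] is the point of [M] that corresponds to [y] in the copy of [M] filling its component. *)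
pose f y := et (r y) (iv y).
have fsg s x : r s = s -> f (sg s x) = et s x.
  move=> rs; have E : r (sg s x) = s by rewrite -(ry _ _ (sgl s x)).
  rewrite /f E; congr et; apply: (elementary_inj (sgP s).1).
  by rewrite -{1}E ivP.
have ef : elementary f.
  have [[_ _ _ hmaps _] _ _] := hM; apply/(hmaps _ _ m0 m1 f); split.
    move=> a k phi y ya; have E i : r (y i) = r a by symmetry; apply/ry/ya.
    have -> : y = sg (r a) \o (iv \o y) by apply/funext => i; rewrite /= -(E i) ivP.
    rewrite (sgP (r a)).1 -(eet (r a)); congr eval; apply/funext => i.
    by rewrite /= fsg.
  move=> a b nab fab; apply: nab.
  have h : loc T (io (t (r a))) (io (t (r b))).
    apply: (loc_trans hM m1 (eloc _ (iv a) (rr a))).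
    apply: (loc_trans hM m1 fab); apply: (loc_sym hM m1); exact: eloc.
  move/(loc_elementary M _ _ eio): h => /ry; rewrite !tr// => /tI rab.
  by apply: (loc_trans hM m0 (yr a)); rewrite rab; exact: (loc_sym hM).
move=> n s m rs; rewrite -(elementary_tp _ ef).
by congr tp; apply/funext => i; rewrite /= fsg.
Qed.

Section Ultra.
Variable U : set_system nat.
Context {UU : UltraFilter U}.
Hypothesis oU : \oo `<=` U.
Local Notation M1 := (ultrapower oU M).
Variables (n : nat) (e : equiv_rel 'I_n) (x : 'I_n -> M).
Local Notation Q := {eq_quot e}.

Definition apart (h : Q -> M -> M1) := (forall I, elementary (h I)) /\
  forall I J m m', loc T (h I m) (h J m') -> I = J.

(** Both tuples are compared with a third one, built in a separable elementary submodel [N0] that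
    meets their components. Gluing along the identity sends it to the tuple of [h]; gluing along
    [t], which matches the components met by [h] with those met by [h'], sends it to the tuple of
    [h']. *)
Lemma apart_tp (h h' : Q -> M -> M1) : apart h -> apart h' ->
  tp (fun i => h (\pi_Q i) (x i)) = tp (fun i => h' (\pi_Q i) (x i)).
Proof.
move=> [eh ah] [eh' ah'].
have m1 : model T M1 by exact/ultrapower_model/Th_model.
pose tup (j : 'I_(n + n)) : M1 := match fintype.split j with
  | inl i => h (\pi_Q i) (x i) | inr i => h' (\pi_Q i) (x i) end.
have [N0 [io [eio sN0 [b bP]]]] := Lowenheim_Skolem (lac_language hM) tup.
have m0 : model T N0 by apply/(elementary_Th T eio).
have [r [yr ry]] : exists r : N0 -> N0, (forall y, loc T y (r y)) /\
    forall y z, loc T y z -> r y = r z.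
  apply: equivalence_section => [y|y z|y z w].
  - exact: (loc_refl hM).
  - exact: (loc_sym hM).
  - exact: (loc_trans hM).
have rr y : r (r y) = r y by symmetry; apply: ry.
have /choice[sg sgP] : forall s, exists sg : M -> N0, elementary sg /\
    range sg = [set b | loc T s b].
  by move=> s; have [sg ? ?] := component_copy hM s m0 sN0; exists sg.
pose E (I : Q) := r (b (lshift n (repr I))).
pose E' (I : Q) := r (b (rshift n (repr I))).
have ioE I m : loc T (io (E I)) (h I m).
  apply: (@loc_trans _ _ _ hM _ (io (b (lshift n (repr I))))) => //.
    by apply/(loc_elementary M _ _ eio); apply: (loc_sym hM).
  rewrite -[io _]/((io \o b) _) bP /tup (unsplitK (inl _)) reprK.
  by apply/(loc_elementary M _ _ (eh I)); exact: lac_loc.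
have ioE' I m : loc T (io (E' I)) (h' I m).
  apply: (@loc_trans _ _ _ hM _ (io (b (rshift n (repr I))))) => //.
    by apply/(loc_elementary M _ _ eio); apply: (loc_sym hM).
  rewrite -[io _]/((io \o b) _) bP /tup (unsplitK (inr _)) reprK.
  by apply/(loc_elementary M _ _ (eh' I)); exact: lac_loc.
have [x0] := carrier_inhabited M.
have EI : injective E.
  move=> I J EIJ; apply: (ah _ _ x0 x0); apply: (loc_trans hM m1 _ (ioE J x0)).
  by rewrite -EIJ; exact: (loc_sym hM).
have E'I : injective E'.
  move=> I J EIJ; apply: (ah' _ _ x0 x0); apply: (loc_trans hM m1 _ (ioE' J x0)).
  by rewrite -EIJ; exact: (loc_sym hM).
have [t [tI tr tE]] := @extend_injection N0 Q [set s | r s = s] E E'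
  [seq \pi_Q i | i <- enum 'I_n] EI E'I (fun I => rr _) (fun I => rr _).
have {}tE I : t (E I) = E' I.
  by apply: tE; rewrite -[I]reprK; apply: map_f; rewrite mem_enum.
have main (k : Q -> M -> M1) (t' : N0 -> N0) : (forall I, elementary (k I)) ->
    injective t' -> (forall s, r s = s -> r (t' s) = t' s) ->
    (forall I m, loc T (io (t' (E I))) (k I m)) ->
    tp (fun i => k (\pi_Q i) (x i)) = tp (fun i => sg (E (\pi_Q i)) (x i)).
  move=> ek t'I t'r kE.
  have /choice[et etP] : forall s, exists et : M -> M1, [/\ elementary et,
      forall m, r s = s -> loc T (io (t' s)) (et m) & forall I, s = E I -> et = k I].
    move=> s; have [[I ->]|nI] := pselect (exists I, s = E I).
      by exists (k I); split => // J /EI ->.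
    (* A component that [k] does not prescribe is sent to the one chosen by [t'], through the copies
       of [M] in [N0]. *)
    exists (io \o sg (t' s)); split.
    - by apply: elementary_comp => //; exact: (sgP _).1.
    - move=> m _; apply/(loc_elementary M _ _ eio).
      have : range (sg (t' s)) (sg (t' s) m) by exists m.
      by rewrite (sgP (t' s)).2.
    - by move=> I sE; case: nI; exists I.
  rewrite -(@glue_components N0 M1 io r t' sg et)//.
  - congr tp; apply/funext => i.
    by have [_ _ /(_ _ erefl) ->] := etP (E (\pi_Q i)).
  - by move=> s; have [] := etP s.
  - by move=> s m; have [_ h1 _] := etP s; exact: h1.
  - by move=> i; exact: rr.
by rewrite (main h id)// (main h' t)// => I m; rewrite tE.
Qed.

End Ultra.

Variable d : ptype L 2 -> \bar R.
Hypothesis hd : localising_metric T d.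
Variable dL : Aut M -> Aut M -> R.
Hypothesis hdLd : coarsely_compatible (@interp2 R L d M) dL.

(** Divergence at a single base point [x0] suffices, since the image of each of these maps lies in
    one component and infinite [ldist] separates components. *)
Lemma tends_apart_apart (U : set_system nat) {UU : UltraFilter U} (oU : \oo `<=` U)
    n (e : equiv_rel 'I_n) (g : nat -> {eq_quot e} -> Aut M) : tends_apart dL g ->
  apart (fun I m => uclass oU (fun k => g k I m)).
Proof.
move=> ga; have m1 : model T (ultrapower oU M) by exact/ultrapower_model/Th_model.
have eg I : elementary (fun m => uclass oU (fun k => g k I m)).
  apply: (@ultrapower_elementary R L U UU oU M (fun k => g k I)) => k.
  exact: aut_elementary.
split => // I J m m' IJ; apply/eqP; apply: contrapT => /negP nIJ.
have /hdLd[x0 x0P] := ga I J nIJ.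
have h : loc T (uclass oU (fun k => g k I x0)) (uclass oU (fun k => g k J x0)).
  apply: (loc_trans hM m1 (b := uclass oU (fun k => g k I m))).
    by apply/(loc_elementary M _ _ (eg I)); exact: lac_loc.
  apply: (loc_trans hM m1 IJ).
  by apply/(loc_elementary M _ _ (eg J)); exact: lac_loc.
move/(ldist_loc hd _ _ m1): h.
have := @ultra_ldist R L M d hd U UU oU (fun k => g k I x0) (fun k => g k J x0).
have x0U : (fun k => ldist d (g k I x0) (g k J x0)) @ U --> +oo%E.
  by move=> W /x0P /oU.
by move=> /ultra_cvg_unique /(_ x0U) ->.
Qed.

Lemma definable_unif_continuous (K : uniformType) n (P : ('I_n -> M) -> K) :
  definable P -> predicate_unif_continuous P.
Proof.
move=> [Pt [Pc PE]] V eV; apply: contrapT => nV.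
have [U UU oU] := free_ultrafilter.
have /choice[xy xyP] : forall k : nat, exists xy : ('I_n -> M) * ('I_n -> M),
    (max_dist dist xy.1 xy.2 < (k.+1%:R^-1)%:E)%E /\ ~ V (P xy.1, P xy.2).
  move=> k; apply: contrapT => nxy; apply: nV; exists k.+1%:R^-1 => // x y xy.
  by apply: contrapT => nVxy; apply: nxy; exists (x, y).
have E : (fun i => uclass oU ((fun k => (xy k).1) ^~ i)) =
    (fun i => uclass oU ((fun k => (xy k).2) ^~ i)).
  apply/funext => i; apply: uclass_dist_small => r r0.
  apply: filterS (oU _ (inv_nat_lt r0)) => k kr.
  have k0 : 0 < k.+1%:R^-1 :> R by rewrite invr_gt0.
  have /(max_dist_ltP _ _ _ k0) /(_ i) h := (xyP k).1.
  by apply: lt_trans h _; rewrite lte_fin.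
have [V1 [eV1 V1s V1V]] := entourage_sym_split eV.
have h1 := @ultra_types_cvg R L M U UU oU n K Pt (fun k => (xy k).1) Pc.
have h2 := @ultra_types_cvg R L M U UU oU n K Pt (fun k => (xy k).2) Pc.
rewrite -E in h2.
have [k [/= k1 k2]] := filter_ex (@filterI _ U _ _ _
  (h1 _ (nbhs_entourage _ eV1)) (h2 _ (nbhs_entourage _ eV1))).
move: k1 k2; rewrite /xsection/= !inE => /V1s k1 k2.
by have [_] := xyP k; apply; rewrite !PE; apply: V1V k1 k2.
Qed.

Lemma definable_properly_invariant (K : topologicalType) n (P : ('I_n -> M) -> K) :
  definable P -> properly_invariant dL P.
Proof.
move=> [Pt [Pc PE]] e x g ga; have [U UU oU] := free_ultrafilter.
have m1 : model T (ultrapower oU M) by exact/ultrapower_model/Th_model.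
pose lim (g' : nat -> {eq_quot e} -> Aut M) : 'I_n -> ultrapower oU M :=
  fun i => @uclass R L U UU oU M (fun k => class_act (g' k) x i).
exists (Pt (tp (lim g))).
suff : (fun k => tp (class_act (g k) x)) @ \oo --> tp (lim g).
  move=> h; have -> : (fun k => P (class_act (g k) x)) =
      (fun k => Pt (tp (class_act (g k) x))).
    by apply/funext => k; exact: PE.
  by apply: types_cvg => //; exact: types_tp.
apply/ptws_cvgP => phi; apply/cvg_contractP => r r0; apply: contrapT => nr.
(* A failure of convergence gives a subsequence [k] that still drifts apart; by [apart_tp] its limit
   tuple in [M^U] has the same type, against the choice of [k]. *)
have /choice[k kP] : forall j : nat, exists k : nat, (j <= k)%N /\
    ~ `|contract (tp (class_act (g k) x) phi) - contract (tp (lim g) phi)| < r.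
  move=> j; apply: contrapT => nk; apply: nr; exists j => // k /= jk.
  by apply: contrapT => h; apply: nk; exists k.
have koo : k @ \oo --> \oo.
  move=> A [m _ mA]; exists m => // j /= mj; apply: mA => /=.
  by apply: leq_trans mj _; have [] := kP j.
have ga' : tends_apart dL (fun j => g (k j)).
  by move=> I J IJ; apply: (cvg_comp _ _ koo (ga I J IJ)).
have E : tp (lim g) = tp (lim (fun j => g (k j))).
  exact: (apart_tp x (tends_apart_apart oU ga) (tends_apart_apart oU ga')).
have /cvg_contractP /(_ r r0) /filter_ex[j] :=
  @Los R L U UU oU M n phi (fun j => class_act (g (k j)) x).
have [_] := kP j; rewrite E; apply.
Qed.

End DefinableImpliesProper.

Theorem theorem4p4 (R : realType) (L : language R) (M : mstructure L)
    (d : ptype L 2 -> \bar R) (dL : Aut M -> Aut M -> R)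
    (K : uniformType) (n : nat) (P : ('I_n -> M) -> K)
    (hM : locally_aleph0_categorical M)
    (hd : localising_metric (Th M) d)
    (hdL : left_invariant_pseudometric dL)
    (hdLd : coarsely_compatible (@interp2 R L d M) dL)
    (hKc : compact [set: K]) (hKh : hausdorff_space K) :
  definable P <-> predicate_unif_continuous P /\ properly_invariant dL P.
Proof.
split=> [dP|[uP iP]].
  split; first exact: definable_unif_continuous dP.
  exact: (definable_properly_invariant hM hd hdLd dP).
apply: (definable_of_cauchy hKc hKh) => p V Tp eV.
exact: (proper_cauchy hM hd hdLd uP iP).
Qed.
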